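(* Let $G$ be a compact Lie group with left invariant metric $\rho$ and Haar measure $\mu$, with doubling constant $C_\mu$, and put $s=\log_2C_\mu$. Let $A:G\to\mathrm{Aut}(G)$ be a $\mu$-measurable map and let $k:G\to(0,\infty)$ be a $\mu$-measurable function such that for every $u,x\in G$ and $r>0$ there is a point $x'=x'(x,u,r)\in G$ with $A(u)^{-1}(B(x,r))\subseteq B(x',k(u)r)$. Then for every $\Phi\in L^1_{k^s}(G)$ the Hausdorff operator $$(\mathcal{H}_{\Phi,A}f)(x)=\int_G\Phi(u)f(A(u)(x))\,d\mu(u)$$ is bounded on the real Hardy space $H^1(G)$, and $$\|\mathcal{H}_{\Phi,A}\|\le C_\mu\|\Phi\|_{L^1_{k^s}}.$$
   Context: $B(x,r)$ denotes the ball of radius $r$ around $x$ with respect to $\rho$. The group $G$ with $\rho$ and $\mu$ is a space of homogeneous type: there is a constant $C$ with $\mu(B(x,2r))\le C\mu(B(x,r))$ for all $x\in G$ and $r>0$; the doubling constant $C_\mu$ is the smallest such $C\ge1$. $\mathrm{Aut}(G)$ is the group of (topological) automorphisms of $G$. The kernel $\Phi:G\to\mathbb{C}$ is locally integrable, and $\Phi\in L^1_{k^s}(G)$ means $\|\Phi\|_{L^1_{k^s}}:=\int_G|\Phi(u)|k(u)^s\,d\mu(u)<\infty$. An atom on $G$ is a function $a$ such that (i) the support of $a$ is contained in a ball $B(x,r)$; (ii) $\|a\|_\infty\le1/\mu(B(x,r))$; (iii) $\int_Ga\,d\mu=0$. The real Hardy space $H^1(G)$ consists of the functions $f=\sum_j\lambda_ja_j$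 with $a_j$ atoms and $\sum_j|\lambda_j|<\infty$; $\|f\|_{H^1}$ is the infimum of $\sum_j|\lambda_j|$ over all such representations of $f$. $\|\mathcal{H}_{\Phi,A}\|$ is the operator norm on $H^1(G)$. *)

(* Defs.v *)
From HB Require Import structures.
From mathcomp Require Import all_boot all_order all_algebra.
From mathcomp Require Import all_classical all_reals all_analysis.
From mathcomp Require Import complex.

Set Implicit Arguments.
Unset Strict Implicit.
Unset Printing Implicit Defensive.

Import Order.TTheory GRing.Theory Num.Theory.
Import numFieldNormedType.Exports.

Local Open Scope classical_set_scope.
Local Open Scope ring_scope.

(* A group carrying a metric [mdist]; its topology is the metric topology and
   [ball x r = [set y | mdist x y < r]] (lemma [ballEmdist]).  No compatibility
   between the two structures is built in.  The base point plays no role: it is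
   there because the library generates sigma-algebras on pointed types only. *)
#[short(type="metricGroupType")]
HB.structure Definition MetricGroup (K : numDomainType) :=
  {G of Metric K G & Group G & Pointed G}.

Definition left_invariant_metric (R : realType) (G : metricGroupType R) : Prop :=
  forall g x y : G, mdist (g * x)%g (g * y)%g = mdist x y.

Section smooth.
Context {R : realType}.

Definition line_at n (f : 'rV[R]_n -> R) (x : 'rV[R]_n) (i : 'I_n) (t : R) : R :=
  f (x + t *: delta_mx 0 i).

Definition partial n (i : 'I_n) (f : 'rV[R]_n -> R) (x : 'rV[R]_n) : R :=
  derive1 (line_at f x i) 0.

Definition iter_partial n (s : seq 'I_n) (f : 'rV[R]_n -> R) : 'rV[R]_n -> R :=
  foldr (@partial n) f s.

(* C^oo on the open set U: the partial derivatives of all orders exist and are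
   continuous at the points of U. *)
Definition smooth_on n (U : set 'rV[R]_n) (f : 'rV[R]_n -> R) : Prop :=
  forall (s : seq 'I_n) (x : 'rV[R]_n), U x ->
    {for x, continuous (iter_partial s f)} /\
    forall i : 'I_n, derivable (line_at (iter_partial s f) x i) 0 1.

Definition smooth_map n m (U : set 'rV[R]_n) (f : 'rV[R]_n -> 'rV[R]_m) : Prop :=
  forall j : 'I_m, smooth_on U (fun x => f x 0 j).

End smooth.

Section lie_group.
Context {R : realType} (G : metricGroupType R).

(* A homeomorphism from an open subset of G onto an open subset of R^n; the two
   underlying functions are total but only matter on these sets. *)
Record chart (n : nat) := Chart {
  chart_dom : set G ;
  chart_cod : set 'rV[R]_n ;
  chart_map : G -> 'rV[R]_n ;
  chart_inv : 'rV[R]_n -> G ;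
  chart_dom_open : open chart_dom ;
  chart_cod_open : open chart_cod ;
  chart_mapP : forall x, chart_dom x -> chart_cod (chart_map x) ;
  chart_invP : forall p, chart_cod p -> chart_dom (chart_inv p) ;
  chart_mapK : forall x, chart_dom x -> chart_inv (chart_map x) = x ;
  chart_invK : forall p, chart_cod p -> chart_map (chart_inv p) = p ;
  chart_map_cont : forall x, chart_dom x -> {for x, continuous chart_map} ;
  chart_inv_cont : forall p, chart_cod p -> {for p, continuous chart_inv}
}.

(* G is a (real, finite-dimensional) Lie group: it has a smooth atlas for which
   multiplication and inversion are smooth.  In the clause on multiplication a
   pair of points of R^n is encoded as a row vector of length n + n. *)
Definition lie_group : Prop :=
  exists (n : nat) (atlas : set (chart n)), [/\
    forall x, exists2 c, atlas c & chart_dom c x,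
    forall c d, atlas c -> atlas d ->
      smooth_map
        [set p | chart_cod c p /\ chart_dom d (chart_inv c p)]
        (fun p => chart_map d (chart_inv c p)),
    forall c d e, atlas c -> atlas d -> atlas e ->
      smooth_map
        [set p : 'rV[R]_(n + n) |
          [/\ chart_cod c (lsubmx p), chart_cod d (rsubmx p) &
              chart_dom e (chart_inv c (lsubmx p) * chart_inv d (rsubmx p))%g]]
        (fun p => chart_map e
           (chart_inv c (lsubmx p) * chart_inv d (rsubmx p))%g) &
    forall c d, atlas c -> atlas d ->
      smooth_map
        [set p | chart_cod c p /\ chart_dom d ((chart_inv c p)^-1)%g]
        (fun p => chart_map d ((chart_inv c p)^-1)%g)].

Record automorphism := Automorphism {
  aut_fun :> G -> G ;
  aut_mul : {morph aut_fun : x y / (x * y)%g} ;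
  aut_homeo : exists g : G -> G,
    [/\ cancel aut_fun g, cancel g aut_fun, continuous aut_fun & continuous g]
}.

End lie_group.

(* Borel sigma-algebra of a metric group. *)
Notation borel G := (g_sigma_algebraType (@open G)).

(* Completion of a Borel measure [mu] and its sigma-algebra (Caratheodory
   measurable sets of the outer measure [mu^*]): "mu-measurable" means measurable
   for this sigma-algebra, and all integrals are taken for the completed
   measure. *)
Notation completed_space mu := (caratheodory_type (mu^*)%mu).
Notation completed mu := (@completed_measure_extension _ _ _ mu).

Section haar.
Context {R : realType} {G : metricGroupType R}.
Variable mu : {measure set (borel G) -> \bar R}.

(* A nonzero left-invariant Radon measure. *)
Definition haar_measure : Prop :=
  [/\ forall (g : G) (B : set (borel G)), measurable B ->
        mu [set (g * x)%g | x in B] = mu B,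
      forall K : set G, compact K -> (mu K < +oo)%E,
      forall B : set (borel G), measurable B ->
        mu B = ereal_inf [set mu U | U in [set U : set G | open U /\ B `<=` U]],
      forall U : set G, open U ->
        mu U = ereal_sup [set mu K | K in [set K : set G | compact K /\ K `<=` U]]
    & mu setT != 0%E].

Definition doubling (C : R) : Prop :=
  forall (x : G) (r : R), 0 < r ->
    (mu (ball x (2 * r)) <= C%:E * mu (ball x r))%E.

Definition homogeneous_type : Prop := exists C : R, doubling C.

(* The infimum is attained when [homogeneous_type] holds. *)
Definition doubling_constant : R := inf [set C : R | 1 <= C /\ doubling C].

(* Measurability with respect to the Borel sets of Aut(G) for the compact-open
   topology.  When G is compact, inversion is continuous on Aut(G) for it, so it
   is the usual group topology of Aut(G). *)
Definition measurable_aut (A : G -> automorphism G) : Prop :=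
  forall V : set {compact-open, G -> G}, open V ->
    measurable ([set u | V (A u)] : set (completed_space mu)).

Definition cmeasurable (f : G -> R[i]) : Prop :=
  measurable_fun setT (fun x : completed_space mu => complex.Re (f x)) /\
  measurable_fun setT (fun x : completed_space mu => complex.Im (f x)).

Definition cintegrable (f : G -> R[i]) : Prop :=
  (completed mu).-integrable setT (fun x => (complex.Re (f x))%:E) /\
  (completed mu).-integrable setT (fun x => (complex.Im (f x))%:E).

Definition cintegral (f : G -> R[i]) : R[i] :=
  Complex (\int[completed mu]_x complex.Re (f x)) (\int[completed mu]_x complex.Im (f x)).

(* The real-valued modulus; the library's norm [`|z|] is valued in R[i]. *)
Definition cabs (z : R[i]) : R := ComplexField.Normc.normc z.

Definition clocally_integrable (f : G -> R[i]) : Prop :=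
  cmeasurable f /\
  forall K : set G, compact K ->
    (\int[completed mu]_(x in K) (cabs (f x))%:E < +oo)%E.

Definition weighted_L1_norm (k : G -> R) (s : R) (f : G -> R[i]) : \bar R :=
  (\int[completed mu]_u (cabs (f u) * k u `^ s)%:E)%E.

Definition atom (a : G -> R[i]) : Prop :=
  cmeasurable a /\
  exists (x : G) (r : R),
    [/\ 0 < r,
        [set y | a y != 0] `<=` ball x r,
        ('N[completed mu]_+oo[EFin \o (cabs \o a)] <=
           ((fine (mu (ball x r)))^-1)%:E)%E
      & cintegral a = 0].

(* f = \sum_j l_j a_j, the series converging in L^1. *)
Definition atomic_decomposition
    (f : G -> R[i]) (l : nat -> R[i]) (a : nat -> G -> R[i]) : Prop :=
  [/\ forall j, atom (a j),
      (\sum_(0 <= j <oo) (cabs (l j))%:E < +oo)%E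
    & (fun n : nat =>
         \int[completed mu]_x (cabs (f x - \sum_(j < n) l j * a j x))%:E)%E
        @ \oo --> 0%E].

(* Elements of H^1(G) are represented by mu-measurable functions, two of them
   being identified when they are equal almost everywhere. *)
Definition in_H1 (f : G -> R[i]) : Prop :=
  cmeasurable f /\ exists l a, atomic_decomposition f l a.

Definition H1_norm (f : G -> R[i]) : \bar R :=
  ereal_inf [set c | exists l a, atomic_decomposition f l a /\
                       c = (\sum_(0 <= j <oo) (cabs (l j))%:E)%E].

Definition ae_equal (f g : G -> R[i]) : Prop :=
  {ae completed mu, forall x, f x = g x}.

Definition H1_operator_norm (T : (G -> R[i]) -> G -> R[i]) : \bar R :=
  ereal_sup [set H1_norm (T f) | f in [set f | in_H1 f /\ (H1_norm f <= 1)%E]].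

(* T induces a bounded linear operator on the space of classes H^1(G). *)
Definition H1_bounded (T : (G -> R[i]) -> G -> R[i]) : Prop :=
  [/\ forall f, in_H1 f -> in_H1 (T f),
      forall f g, in_H1 f -> in_H1 g -> ae_equal f g -> ae_equal (T f) (T g),
      forall (c : R[i]) f g, in_H1 f -> in_H1 g ->
        ae_equal (T (fun x => c * f x + g x)) (fun x => c * T f x + T g x)
    & (H1_operator_norm T < +oo)%E].

Definition hausdorff_operator (Phi : G -> R[i]) (A : G -> automorphism G)
    (f : G -> R[i]) (x : G) : R[i] :=
  cintegral (fun u => Phi u * f (A u x)).

End haar.

(* Main.v *)
Require Import Defs.
From HB Require Import structures.
From mathcomp Require Import all_boot all_order all_algebra.
From mathcomp Require Import all_classical all_reals all_analysis.
From mathcomp Require Import complex.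
From mathcomp Require Import measurable_realfun ess_sup_inf.
From mathcomp Require Import ring lra.
Import Order.TTheory GRing.Theory Num.Theory.
Import numFieldNormedType.Exports.
Local Open Scope classical_set_scope.
Local Open Scope ring_scope.

(** Write [T f x] for the integral over [u] of [Phi u * f (A u x)].  If [a] is
    an atom of the ball [B(x, r)], then [a (A u _)] has the same bound, mean zero
    (an automorphism preserves Haar measure), and its support lies in a ball of
    radius [k u * r], whose mass is at most [Cmu * (k u) ^ s] times that of
    [B(x, r)].  So [a (A u _)] is [Cmu * (k u) ^ s] times an atom, and [T a] is an
    integral of such multiples of atoms, of total weight
    [Cmu * |Phi| * (k u) ^ s] integrated over [u].  This heuristic is made rigorous as follows.

    The integral over [u] has to become a series of atoms, with no loss in the
    constant.  The parameters are divided into countably many cells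
    ([pullback_cell], [exists_pullback_partition]).  On a cell, the least
    natural number [n] with [k u < 2 ^ n] is fixed, and all the sets
    [A u @^-1` B(x, r)] lie in one ball [B(y, 2 ^ n * r)], where [y] belongs to a
    countable dense set; since [k u < 2 ^ n] strictly, such a [y] exists for each
    [u].  Integrating [Phi u * a (A u _)] over a cell therefore gives a multiple
    of a single atom of [B(y, 2 ^ n * r)] ([piece_atom_atom]), and its coefficient
    is controlled by [Cmu ^ n <= Cmu * (k u) ^ s] ([dyadic_level_bound]).  For
    [n = 0] this inequality is not a consequence of doubling alone; but if [k u < 1]
    for some [u], then [A u] shows that all balls have the same mass, so that
    [Cmu = 1] and [s = 0] ([doubling_constant_contracting]).

    For [f] the sum of the [l j * a j], the atoms indexed by the pairs of a term
    [j] and a cell form one series.  It converges to [T f] in [L^1]: by Tonelli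
    and invariance of the measure the error is at most the integral over [u] of
    [|Phi u|] times the [L^1] norm of [f] minus the terms [l j * a j] whose cell
    containing [u] has been reached.  For each [u] this is a rearranged partial
    sum of an absolutely summable series ([rearranged_series_cvg]), and dominated
    convergence applies ([superposed_series_cvg]).

    Automorphisms preserve Haar measure ([automorphism_haar]) because the
    push-forward of [mu] by one of them gives all balls of a given radius the same
    positive mass, as [mu] does, and on a compact metric space a measure with this
    property is determined by its total mass ([uniformly_distributed_unique]).

    Measurability is the other concern: [f] is measurable for the completed
    measure only, so [f (A u x)] need not be jointly measurable.  Functions are
    replaced by Borel ones outside of one Borel null set [N]
    ([borel_restriction]), which is harmless because, for almost every [x], the
    point [A u x] avoids [N] for almost every [u] ([ae_act_null]). *)

Set Implicit Arguments.
Unset Strict Implicit.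
Unset Printing Implicit Defensive.

(** * Complex-valued functions and their integrals *)

Section modulus.
Context {R : realType}.
Implicit Types z w : R[i].

Lemma complex_ReD z w : complex.Re (z + w) = complex.Re z + complex.Re w.
Proof. by case: z; case: w. Qed.
Lemma complex_ImD z w : complex.Im (z + w) = complex.Im z + complex.Im w.
Proof. by case: z; case: w. Qed.
Lemma complex_ReM z w : complex.Re (z * w) =
  complex.Re z * complex.Re w - complex.Im z * complex.Im w.
Proof. by case: z; case: w. Qed.
Lemma complex_ImM z w : complex.Im (z * w) =
  complex.Re z * complex.Im w + complex.Im z * complex.Re w.
Proof. by case: z; case: w. Qed.

Lemma cabs_ge0 z : 0 <= cabs z.
Proof. by case: z => a b; rewrite /cabs /= sqrtr_ge0. Qed.

Lemma cabs0 : cabs (0 : R[i]) = 0.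
Proof. exact: ComplexField.Normc.normc0. Qed.

Lemma cabsM z w : cabs (z * w) = cabs z * cabs w.
Proof. exact: ComplexField.Normc.normcM. Qed.

Lemma cabsD z w : cabs (z + w) <= cabs z + cabs w.
Proof. exact: le_normcD. Qed.

Lemma cabsN z : cabs (- z) = cabs z.
Proof. exact: normcN. Qed.

Lemma cabsB z w : cabs (z - w) <= cabs z + cabs w.
Proof. by rewrite -(cabsN w) cabsD. Qed.

Lemma cabs_real (a : R) : cabs (a%:C)%C = `|a|.
Proof. by rewrite /cabs /= expr0n/= addr0 sqrtr_sqr. Qed.

Lemma cabs_sum (I : Type) (s : seq I) (Q : pred I) (F : I -> R[i]) :
  cabs (\sum_(i <- s | Q i) F i) <= \sum_(i <- s | Q i) cabs (F i).
Proof.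
elim/big_ind2: _ => [|x a y b xa yb|//]; first by rewrite cabs0.
by rewrite (le_trans (cabsD _ _))// lerD.
Qed.

Lemma cabs_sqr z : cabs z ^+ 2 = complex.Re z ^+ 2 + complex.Im z ^+ 2.
Proof. by case: z => a b /=; rewrite /cabs /= sqr_sqrtr// addr_ge0 ?sqr_ge0. Qed.

Let sq_norm (a : R) : `|a| ^+ 2 = a ^+ 2.
Proof. by rewrite real_normK// num_real. Qed.

Lemma Re_le_cabs z : `|complex.Re z| <= cabs z.
Proof.
rewrite -(@ler_pXn2r _ 2)// ?nnegrE ?cabs_ge0//.
by rewrite cabs_sqr sq_norm lerDl sqr_ge0.
Qed.

Lemma Im_le_cabs z : `|complex.Im z| <= cabs z.
Proof.
rewrite -(@ler_pXn2r _ 2)// ?nnegrE ?cabs_ge0//.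
by rewrite cabs_sqr sq_norm lerDr sqr_ge0.
Qed.

Lemma cabs_le_ReIm z : cabs z <= `|complex.Re z| + `|complex.Im z|.
Proof.
rewrite -(@ler_pXn2r _ 2)// ?nnegrE ?cabs_ge0// ?addr_ge0//.
rewrite cabs_sqr sqrrD !sq_norm -addrA lerD2l addrC lerDl.
by rewrite mulrn_wge0// mulr_ge0.
Qed.

End modulus.

(** The notions [cmeasurable], [cintegrable] and [cintegral] on an arbitrary
    measure space: Borel functions, sections and functions on products are needed
    along with functions on the completed space. *)
Section complex_functions.
Context {d : measure_display} {T : measurableType d} {R : realType}.
Implicit Types f g : T -> R[i].

Definition measurable_complex f :=
  measurable_fun setT (fun x => complex.Re (f x)) /\
  measurable_fun setT (fun x => complex.Im (f x)).

Lemma measurable_complex_cst (c : R[i]) : measurable_complex (fun=> c).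
Proof. by split; exact: measurable_cst. Qed.

Lemma measurable_complexD f g : measurable_complex f -> measurable_complex g ->
  measurable_complex (fun x => f x + g x).
Proof.
move=> [f1 f2] [g1 g2]; split.
  by under eq_fun do rewrite complex_ReD; exact: measurable_funD.
by under eq_fun do rewrite complex_ImD; exact: measurable_funD.
Qed.

Lemma measurable_complexM f g : measurable_complex f -> measurable_complex g ->
  measurable_complex (fun x => f x * g x).
Proof.
move=> [f1 f2] [g1 g2]; split.
  by under eq_fun do rewrite complex_ReM; apply: measurable_funB; exact: measurable_funM.
by under eq_fun do rewrite complex_ImM; apply: measurable_funD; exact: measurable_funM.
Qed.

Lemma measurable_complexN f : measurable_complex f ->
  measurable_complex (fun x => - f x).
Proof.
move=> mf; under eq_fun do rewrite -mulN1r.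
exact: measurable_complexM (measurable_complex_cst _) mf.
Qed.

Lemma measurable_complexB f g : measurable_complex f -> measurable_complex g ->
  measurable_complex (fun x => f x - g x).
Proof. by move=> mf /measurable_complexN; exact: measurable_complexD. Qed.

Lemma measurable_complex_sum (I : Type) (s : seq I) (Q : pred I) (F : I -> T -> R[i]) :
  (forall i, measurable_complex (F i)) ->
  measurable_complex (fun x => \sum_(i <- s | Q i) F i x).
Proof.
move=> mF; elim: s => [|i s IH].
  by under eq_fun do rewrite big_nil; exact: measurable_complex_cst.
under eq_fun do rewrite big_cons.
by case: (Q i) => //; apply: measurable_complexD.
Qed.

Lemma measurable_complex_indic (D : set T) : measurable D ->
  measurable_complex (fun x => ((\1_D x : R)%:C)%C).
Proof. by move=> mD; split; [exact: measurable_indic|exact: measurable_cst]. Qed.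

Lemma measurable_cabs f : measurable_complex f ->
  measurable_fun setT (fun x => cabs (f x)).
Proof.
move=> [f1 f2].
have -> : (fun x => cabs (f x)) =
    (@Num.sqrt R) \o (fun x => complex.Re (f x) ^+ 2 + complex.Im (f x) ^+ 2).
  by apply/funext => x; rewrite /cabs /=; case: (f x).
apply: measurableT_comp; first exact: continuous_measurable_fun (@sqrt_continuous R).
by apply: measurable_funD; exact: measurable_funX.
Qed.

Lemma measurable_cabse f : measurable_complex f ->
  measurable_fun setT (fun x => (cabs (f x))%:E).
Proof. by move=> /measurable_cabs mf; apply/measurable_EFinP. Qed.

End complex_functions.

Lemma measurable_complex_comp {d1 d2 : measure_display} {T1 : measurableType d1}
    {T2 : measurableType d2} {R : realType} (f : T2 -> R[i]) (h : T1 -> T2) :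
  measurable_fun setT h -> measurable_complex f ->
  measurable_complex (fun x => f (h x)).
Proof.
move=> mh [f1 f2]; split; first exact: (measurableT_comp f1).
exact: (measurableT_comp f2).
Qed.

Section complex_integral.
Context {d : measure_display} {T : measurableType d} {R : realType}.
Variable m : {measure set T -> \bar R}.
Implicit Types f g : T -> R[i].

Definition integrable_complex f :=
  m.-integrable setT (fun x => (complex.Re (f x))%:E) /\
  m.-integrable setT (fun x => (complex.Im (f x))%:E).

Definition integral_complex f : R[i] :=
  Complex (\int[m]_x complex.Re (f x)) (\int[m]_x complex.Im (f x)).

Lemma integrable_complexP f : integrable_complex f <->
  measurable_complex f /\ (\int[m]_x (cabs (f x))%:E < +oo)%E.
Proof.
split=> [[f1 f2]|[[f1 f2] fi]].
  have m1 := measurable_int _ f1; have m2 := measurable_int _ f2.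
  have mf : measurable_complex f by split; exact/measurable_EFinP.
  split=> //; apply: (@le_lt_trans _ _ (\int[m]_x
     (`|(complex.Re (f x))%:E| + `|(complex.Im (f x))%:E|))%E).
    apply: ge0_le_integral => //.
    - by move=> x _; rewrite lee_fin cabs_ge0.
    - exact: measurable_cabse.
    - by apply: emeasurable_funD; exact: measurableT_comp.
    - by move=> x _ /=; rewrite -EFinD lee_fin cabs_le_ReIm.
  rewrite ge0_integralD//; [|exact: measurableT_comp..].
  by rewrite lte_add_pinfty//; [move/integrableP: f1 => []|move/integrableP: f2 => []].
split; apply/integrableP; split; [exact/measurable_EFinP| |exact/measurable_EFinP|];
  apply: le_lt_trans fi; apply: ge0_le_integral => //;
  do ?[by apply: measurableT_comp => //; exact/measurable_EFinP];
  do ?[by apply: measurable_cabse]; move=> x _ /=.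
- by rewrite lee_fin Re_le_cabs.
- by rewrite lee_fin Im_le_cabs.
Qed.

Lemma integrable_complexD f g : integrable_complex f -> integrable_complex g ->
  integrable_complex (fun x => f x + g x).
Proof.
move=> [f1 f2] [g1 g2]; split.
  by under eq_fun do rewrite complex_ReD EFinD; exact: integrableD.
by under eq_fun do rewrite complex_ImD EFinD; exact: integrableD.
Qed.

Lemma integrable_complexZ (c : R[i]) f : integrable_complex f ->
  integrable_complex (fun x => c * f x).
Proof.
move=> [f1 f2]; split.
  under eq_fun do rewrite complex_ReM EFinB !EFinM.
  by apply: integrableB => //; exact: integrableZl.
under eq_fun do rewrite complex_ImM EFinD !EFinM.
by apply: integrableD => //; exact: integrableZl.
Qed.

Lemma integrable_complex0 : integrable_complex (fun=> 0).
Proof. by split; exact: integrable0. Qed.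

Lemma integrable_complex_sum (I : Type) (s : seq I) (Q : pred I) (F : I -> T -> R[i]) :
  (forall i, integrable_complex (F i)) ->
  integrable_complex (fun x => \sum_(i <- s | Q i) F i x).
Proof.
move=> mF; elim: s => [|i s IH].
  by under eq_fun do rewrite big_nil; exact: integrable_complex0.
under eq_fun do rewrite big_cons.
by case: (Q i) => //; apply: integrable_complexD.
Qed.

Lemma integral_complexD f g : integrable_complex f -> integrable_complex g ->
  integral_complex (fun x => f x + g x) = integral_complex f + integral_complex g.
Proof.
move=> [f1 f2] [g1 g2]; rewrite /integral_complex.
apply/eqP; rewrite eq_complex/=; apply/andP; split; apply/eqP.
  by under eq_Rintegral do rewrite complex_ReD; rewrite RintegralD.
by under eq_Rintegral do rewrite complex_ImD; rewrite RintegralD.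
Qed.

Let integrableZR (c : R) (h : T -> R) : m.-integrable setT (EFin \o h) ->
  m.-integrable setT (EFin \o (fun x => c * h x)).
Proof. by move=> ih; rewrite (_ : _ \o _ = fun x => c%:E * (EFin \o h) x)%E//; exact: integrableZl. Qed.

Lemma integral_complexZ (c : R[i]) f : integrable_complex f ->
  integral_complex (fun x => c * f x) = c * integral_complex f.
Proof.
move=> [f1 f2]; rewrite /integral_complex.
apply/eqP; rewrite eq_complex/= complex_ReM complex_ImM /=; apply/andP; split; apply/eqP.
  under eq_Rintegral do rewrite complex_ReM.
  rewrite RintegralB ?RintegralZl//; exact: integrableZR.
under eq_Rintegral do rewrite complex_ImM.
rewrite RintegralD ?RintegralZl//; exact: integrableZR.
Qed.

Lemma integral_complexB f g : integrable_complex f -> integrable_complex g ->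
  integral_complex (fun x => f x - g x) = integral_complex f - integral_complex g.
Proof.
move=> f1 g1; rewrite -[X in _ - X]mul1r -mulNr -integral_complexZ//.
rewrite -integral_complexD//; last exact: integrable_complexZ.
by congr integral_complex; apply/funext => x; rewrite mulN1r.
Qed.

Lemma integral_complex0 : integral_complex (fun=> 0) = 0.
Proof. by rewrite /integral_complex /Rintegral /= integral0. Qed.

Lemma integral_complex_sum (I : Type) (s : seq I) (Q : pred I) (F : I -> T -> R[i]) :
  (forall i, integrable_complex (F i)) ->
  integral_complex (fun x => \sum_(i <- s | Q i) F i x) =
  \sum_(i <- s | Q i) integral_complex (F i).
Proof.
move=> mF; elim: s => [|i s IH].
  by under eq_fun do rewrite big_nil; rewrite big_nil integral_complex0.
rewrite big_cons; under eq_fun do rewrite big_cons.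
case: (Q i) => //; rewrite integral_complexD ?IH//.
exact: integrable_complex_sum.
Qed.

(** With [I] the integral, [|I| ^ 2] is the integral of
    [Re I * Re f + Im I * Im f], which Cauchy-Schwarz bounds by [|I| * |f|]. *)
Lemma cabs_integral_complex f : measurable_complex f ->
  ((cabs (integral_complex f))%:E <= \int[m]_x (cabs (f x))%:E)%E.
Proof.
move=> mf.
have [fi|] := ltP (\int[m]_x (cabs (f x))%:E)%E +oo%E; last first.
  by rewrite leye_eq => /eqP ->; rewrite leey.
have [f1 f2] : integrable_complex f by apply/integrable_complexP.
set I := integral_complex f.
have ic : m.-integrable setT (fun x => (cabs (f x))%:E).
  apply/integrableP; split; first exact: measurable_cabse.
  by under eq_integral do rewrite gee0_abs ?lee_fin ?cabs_ge0//.
have -> : (\int[m]_x (cabs (f x))%:E)%E = (\int[m]_x cabs (f x))%:E.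
  by rewrite /Rintegral fineK// integrable_fin_num.
rewrite lee_fin.
have [I0|I0] := eqVneq (cabs I) 0.
  by rewrite I0; apply: Rintegral_ge0 => x _; exact: cabs_ge0.
have Ip : 0 < cabs I by rewrite lt_neqAle eq_sym I0 cabs_ge0.
rewrite -(ler_pM2l Ip) -expr2 cabs_sqr -RintegralZl//.
rewrite [complex.Re I]/= [complex.Im I]/= !expr2.
have i1 (c : R) := integrableZR c f1.
have i2 (c : R) := integrableZR c f2.
rewrite -2?RintegralZl// -RintegralD//.
apply: le_Rintegral => //.
- rewrite (_ : _ \o _ = (EFin \o (fun x => complex.Re I * complex.Re (f x))%R) \+
    (EFin \o (fun x => complex.Im I * complex.Im (f x))%R))%E//.
  exact: integrableD.
- exact: integrableZR.
move=> x _; rewrite -/(complex.Re I) -/(complex.Im I).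
set a := \int[m]_x0 _; set b := \int[m]_x0 _.
have -> : I = Complex a b by [].
apply: le_trans (ler_norm _) _.
rewrite -(@ler_pXn2r _ 2)// ?nnegrE ?mulr_ge0 ?cabs_ge0//.
rewrite (real_normK (num_real _)) exprMn !cabs_sqr /=.
rewrite -subr_ge0 (_ : _ - _ = (a * complex.Im (f x) - b * complex.Re (f x)) ^+ 2) ?sqr_ge0//.
by ring.
Qed.

Lemma ae_eq_integral_complex f g :
  measurable_complex f -> measurable_complex g ->
  {ae m, forall x, f x = g x} -> integral_complex f = integral_complex g.
Proof.
move=> [f1 f2] [g1 g2] fg; rewrite /integral_complex /Rintegral.
congr Complex; congr fine; apply: ae_eq_integral => //;
  do ?[exact/measurable_EFinP]; apply: filterS fg => x -> _ //.
Qed.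

End complex_integral.

(** * Tonelli and Fubini for complex-valued kernels *)

Section complex_fubini.
Context {d1 d2 : measure_display} {T1 : measurableType d1}
  {T2 : measurableType d2} {R : realType}.
Variable m1 : {sigma_finite_measure set T1 -> \bar R}.
Variable m2 : {sigma_finite_measure set T2 -> \bar R}.

(** The inner integral is the difference of those of the positive and negative
    parts, which Tonelli makes measurable even where they are infinite. *)
Lemma measurable_fubini_real (h : T1 * T2 -> R) : measurable_fun setT h ->
  measurable_fun setT (fun y => \int[m1]_x h (x, y)).
Proof.
move=> mh; have mh' : measurable_fun setT (EFin \o h) by exact/measurable_EFinP.
rewrite /Rintegral; apply: (measurableT_comp (fine_measurable measurableT)).
have -> : (fun y => \int[m1]_x (h (x, y))%:E)%E =
   ((fun y => \int[m1]_x (EFin \o h)^\+ (x, y)) \-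
    (fun y => \int[m1]_x (EFin \o h)^\- (x, y)))%E.
  apply/funext => y; rewrite [LHS]integralE.
  by congr (_ - _)%E; apply: eq_integral => x _; rewrite ?funeposE ?funenegE.
apply: emeasurable_funB;
  apply: (@measurable_fun_fubini_tonelli_G _ _ _ _ _ m1) => //.
  exact: measurable_funepos.
exact: measurable_funeneg.
Qed.

Lemma measurable_fubini_complex (H : T1 * T2 -> R[i]) : measurable_complex H ->
  measurable_complex (fun y => integral_complex m1 (fun x => H (x, y))).
Proof.
move=> [H1 H2]; split.
  exact: (@measurable_fubini_real (fun z => complex.Re (H z))).
exact: (@measurable_fubini_real (fun z => complex.Im (H z))).
Qed.

Lemma measurable_complex_pair1 (H : T1 * T2 -> R[i]) (x : T1) :
  measurable_complex H -> measurable_complex (fun y => H (x, y)).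
Proof. exact: measurable_complex_comp (measurable_pair1 x). Qed.

Lemma measurable_complex_pair2 (H : T1 * T2 -> R[i]) (y : T2) :
  measurable_complex H -> measurable_complex (fun x => H (x, y)).
Proof. exact: measurable_complex_comp (measurable_pair2 y). Qed.

Lemma measurable_fubini_cabs (H : T1 * T2 -> R[i]) : measurable_complex H ->
  measurable_fun setT (fun x => \int[m2]_y (cabs (H (x, y)))%:E)%E.
Proof.
move=> mH; apply: (@measurable_fun_fubini_tonelli_F _ _ _ _ _ m2
    (fun z => (cabs (H z))%:E)).
- exact: measurable_cabse.
- by move=> z; rewrite lee_fin cabs_ge0.
Qed.

Lemma fubini_tonelli_cabs (H : T1 * T2 -> R[i]) : measurable_complex H ->
  (\int[m1]_x \int[m2]_y (cabs (H (x, y)))%:E =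
   \int[m2]_y \int[m1]_x (cabs (H (x, y)))%:E)%E.
Proof.
move=> mH; apply: (@fubini_tonelli _ _ _ _ _ m1 m2
    (fun z => (cabs (H z))%:E)).
- exact: measurable_cabse.
- by move=> z; rewrite lee_fin cabs_ge0.
Qed.

(** Minkowski's inequality for the [L^1] norm of an integral of functions. *)
Lemma minkowski_integral (H : T1 * T2 -> R[i]) : measurable_complex H ->
  (\int[m2]_y (cabs (integral_complex m1 (fun x => H (x, y))))%:E <=
   \int[m1]_x \int[m2]_y (cabs (H (x, y)))%:E)%E.
Proof.
move=> mH; rewrite fubini_tonelli_cabs//; apply: ge0_le_integral => //.
- by move=> y _; rewrite lee_fin cabs_ge0.
- by apply: measurable_cabse; exact: measurable_fubini_complex.
- apply: (@measurable_fun_fubini_tonelli_G _ _ _ _ _ m1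
    (fun z => (cabs (H z))%:E)).
  + exact: measurable_cabse.
  + by move=> z; rewrite lee_fin cabs_ge0.
- move=> y _; apply: cabs_integral_complex.
  exact: measurable_complex_pair2.
Qed.

Section integrable_kernel.
Variable H : T1 * T2 -> R[i].
Hypothesis mH : measurable_complex H.
Hypothesis Hoo : (\int[m1]_x \int[m2]_y (cabs (H (x, y)))%:E < +oo)%E.

Let iRe : (m1 \x m2)%E.-integrable setT (fun z => (complex.Re (H z))%:E).
Proof.
apply/integrable12ltyP; first by apply/measurable_EFinP; exact: mH.1.
apply: le_lt_trans Hoo; apply: ge0_le_integral => //.
- by move=> x _; exact: integral_ge0.
- apply: (@measurable_fun_fubini_tonelli_F _ _ _ _ _ m2
    (fun z => `|(complex.Re (H z))%:E|%E)) => //.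
  by apply: measurableT_comp => //; apply/measurable_EFinP; exact: mH.1.
- exact: measurable_fubini_cabs.
- move=> x _; apply: ge0_le_integral => //.
  + apply: measurableT_comp => //; apply/measurable_EFinP.
    exact: (measurable_complex_pair1 x mH).1.
  + apply: measurable_cabse; exact: measurable_complex_pair1.
  + by move=> y _; rewrite lee_fin Re_le_cabs.
Qed.

Let iIm : (m1 \x m2)%E.-integrable setT (fun z => (complex.Im (H z))%:E).
Proof.
apply/integrable12ltyP; first by apply/measurable_EFinP; exact: mH.2.
apply: le_lt_trans Hoo; apply: ge0_le_integral => //.
- by move=> x _; exact: integral_ge0.
- apply: (@measurable_fun_fubini_tonelli_F _ _ _ _ _ m2
    (fun z => `|(complex.Im (H z))%:E|%E)) => //.
  by apply: measurableT_comp => //; apply/measurable_EFinP; exact: mH.2.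
- exact: measurable_fubini_cabs.
- move=> x _; apply: ge0_le_integral => //.
  + apply: measurableT_comp => //; apply/measurable_EFinP.
    exact: (measurable_complex_pair1 x mH).2.
  + apply: measurable_cabse; exact: measurable_complex_pair1.
  + by move=> y _; rewrite lee_fin Im_le_cabs.
Qed.

Lemma ae_integrable_complex :
  {ae m2, forall y, integrable_complex m1 (fun x => H (x, y))}.
Proof.
by apply: filterS2 (ae_integrable2 iRe) (ae_integrable2 iIm) => y h1 h2; split.
Qed.

Let fubini_real (h : T1 * T2 -> R) : (m1 \x m2)%E.-integrable setT (EFin \o h) ->
  \int[m2]_y \int[m1]_x h (x, y) = \int[m1]_x \int[m2]_y h (x, y).
Proof.
move=> ih; rewrite /Rintegral; congr fine.
transitivity (\int[m2]_y \int[m1]_x (EFin \o h) (x, y))%E.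
  apply: ae_eq_integral => //.
  - apply/measurable_EFinP; apply: measurable_fubini_real.
    by apply/measurable_EFinP; exact: measurable_int ih.
  - exact: measurable_fubini_G ih.
  - apply: filterS (ae_integrable2 ih) => y hy _ /=.
    by rewrite fineK//; exact: integrable_fin_num.
rewrite -(Fubini ih).
apply/esym; apply: ae_eq_integral => //.
- apply/measurable_EFinP/(measurableT_comp (fine_measurable measurableT)).
  exact: measurable_fubini_F ih.
- exact: measurable_fubini_F ih.
- apply: filterS (ae_integrable1 ih) => y hy _ /=.
  by rewrite fineK//; exact: integrable_fin_num.
Qed.

Lemma fubini_complex :
  integral_complex m2 (fun y => integral_complex m1 (fun x => H (x, y))) =
  integral_complex m1 (fun x => integral_complex m2 (fun y => H (x, y))).
Proof.
rewrite /integral_complex /=; congr Complex.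
  exact: (fubini_real iRe).
exact: (fubini_real iIm).
Qed.

End integrable_kernel.

End complex_fubini.

(** * Borel versions of functions that are measurable for a completed measure *)

Section finite_measure.
Context {d : measure_display} {T : measurableType d} {R : realType}.
Variables (m : {measure set T -> \bar R}) (mfin : (m setT < +oo)%E).

Lemma finite_fin_num_fun : fin_num_fun m.
Proof.
move=> B mB; rewrite ge0_fin_numE//; apply: le_lt_trans mfin.
by apply: le_measure; rewrite ?inE.
Qed.

(** A copy of [m] that carries the finite measure structure, so that [m] can
    be used in product measures. *)
Definition finite_copy : set T -> \bar R := let _ := mfin in m.

HB.instance Definition _ := isMeasure.Build _ _ _ finite_copy
  (measure0 m) (measure_ge0 m) (@measure_semi_sigma_additive _ _ _ m).

HB.instance Definition _ := Measure_isFinite.Build _ _ _ finite_copy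
  finite_fin_num_fun.

End finite_measure.

Section completion.
Context {d : measure_display} {T : measurableType d} {R : realType}.
Variable mu : {measure set T -> \bar R}.
Local Notation P := (completed mu).

Lemma completed_measurable (B : set T) :
  measurable B -> measurable (B : set (completed_space mu)).
Proof. exact: caratheodory_measurable_mu_ext. Qed.

Lemma completedE (B : set T) : measurable B -> P B = mu B.
Proof. by move=> mB; exact: measurable_mu_extE. Qed.

Lemma completed_is_complete : measure_is_complete P.
Proof. exact: (@measure_is_complete_caratheodory _ _ (mu^*)%mu). Qed.

Lemma measurable_fun_completed {d'} {T' : measurableType d'} (f : T -> T') :
  measurable_fun setT f -> measurable_fun setT (f : completed_space mu -> T').
Proof. by move=> mf _ B mB; apply: completed_measurable; exact: mf. Qed.

Hypothesis mufin : (mu setT < +oo)%E.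

Lemma completed_lty : (P setT < +oo)%E.
Proof. by rewrite completedE. Qed.

Let completed_fin_num_fun : fin_num_fun P.
Proof. exact: (finite_fin_num_fun completed_lty). Qed.

(** The intersection of countably many almost optimal covers. *)
Lemma measurable_hull (A : set T) : exists B, [/\ measurable B, A `<=` B & mu B = P A].
Proof.
have Pfin : P A \is a fin_num.
  rewrite ge0_fin_numE; last exact: mu_ext_ge0.
  apply: le_lt_trans mufin; rewrite -completedE//.
  exact: (le_mu_ext mu (@subsetT _ A)).
have H n : exists B, [/\ measurable B, A `<=` B & (mu B <= P A + (n.+1%:R^-1)%:E)%E].
  have e0 : (0 < n.+1%:R^-1 :> R) by rewrite invr_gt0.
  have [_ [F [mF AF] <-] Fe] := lb_ereal_inf_adherent e0 Pfin.
  exists (\bigcup_i F i); split => //; first exact: bigcupT_measurable.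
  apply: le_trans (ltW Fe); apply: measure_sigma_subadditive => //.
  exact: bigcupT_measurable.
have [F HF] := choice H.
have mF : measurable (\bigcap_i F i).
  by apply: bigcapT_measurable => i; have [] := HF i.
exists (\bigcap_i F i); split => //.
  by move=> x Ax i _; have [_ + _] := HF i; exact.
apply/eqP; rewrite eq_le; apply/andP; split; last first.
  rewrite -(completedE mF); apply: le_mu_ext => x Ax i _.
  by have [_ + _] := HF i; exact.
apply/lee_addgt0Pr => e e0.
have [n ne] : exists n, (n.+1%:R^-1 < e :> R).
  have [n] := ltr_add_invr e0; rewrite add0r => ?; by exists n.
have [mFn _ Fn] := HF n.
apply: (@le_trans _ _ (mu (F n))).
  by apply: le_measure; rewrite ?inE//; exact: bigcap_inf.
by apply: le_trans Fn _; rewrite leeD2l// lee_fin ltW.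
Qed.

Lemma completed_null (A : set T) : P.-negligible A ->
  exists N, [/\ measurable N, mu N = 0%E & A `<=` N].
Proof.
move=> [B [mB B0 AB]]; have [N [mN BN N0]] := measurable_hull B.
by exists N; split; [by []|by rewrite N0|exact: subset_trans BN].
Qed.

Lemma completed_measurable_version (A : set (completed_space mu)) : measurable A ->
  exists B N : set T, [/\ measurable B, measurable N, mu N = 0%E & A `\` N = B `\` N].
Proof.
move=> mA; have [B [mB AB BA]] := measurable_hull A.
have mB' := completed_measurable mB.
have : P.-negligible (B `\` A).
  exists (B `\` A); split => //; first exact: measurableD.
  rewrite measureD//; last first.
    by rewrite ltey_eq completed_fin_num_fun.
  rewrite [X in (X - _)%E](completedE mB) BA setIidr// subee//.
  exact: completed_fin_num_fun.
move=> /completed_null [N [mN N0 AN]].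
exists B, N; split => //; apply/seteqP; split => x [xA xN]; split => //.
  exact: AB.
by apply: contrapT => xA'; apply: xN; exact: AN.
Qed.

(** Each of the countably many superlevel sets at a rational height agrees with a
    Borel set outside of a Borel null set; [N] is the union of these null sets. *)
Lemma completed_fun_version (g : T -> R) :
  measurable_fun setT (g : completed_space mu -> R) ->
  exists N : set T, [/\ measurable N, mu N = 0%E & measurable_fun (~` N) g].
Proof.
move=> mg.
have H (q : rat) : exists BN : set T * set T, [/\ measurable BN.1, measurable BN.2,
    mu BN.2 = 0%E & [set x | ratr q < g x] `\` BN.2 = BN.1 `\` BN.2].
  have mA : measurable ([set x | ratr q < g x] : set (completed_space mu)).
    have := mg measurableT `]ratr q, +oo[%classic (measurable_itv _).
    rewrite setTI; congr measurable; apply/seteqP; split => x /=;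
      by rewrite in_itv/= andbT.
  have [B [N [? ? ? ?]]] := completed_measurable_version mA.
  by exists (B, N).
have [F HF] := choice H.
pose N := \bigcup_q (F q).2.
have mN : measurable N by apply: bigcupT_measurable_rat => q; have [] := HF q.
exists N; split => //.
  apply/eqP; rewrite -measure_le0.
  pose h n : set T := if (@pickle_inv rat n) is Some q then (F q).2 else set0.
  have mh n : measurable (h n).
    by rewrite /h; case: pickle_inv => [q|//]; have [] := HF q.
  apply: (@le_trans _ _ (\sum_(0 <= n <oo) mu (h n))%E).
    apply: measure_sigma_subadditive => //.
    by move=> x [q _ Fq]; exists (pickle q); [exact: I|rewrite /h pickleK_inv].
  rewrite eseries0// => n _ _; rewrite /h.
  by case: pickle_inv => [q|]; [have [] := HF q|rewrite measure0].
apply: (measurability _ (RGenOInfty.measurableE R)) => //.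
move=> _ [_ [a ->] <-].
rewrite (_ : _ `&` _ =
    \bigcup_(q in [set q | a < ratr q]) ((F q).1 `\` N)); last first.
  apply/seteqP; split => x.
    move=> [Nx]; rewrite /= in_itv/= andbT => /rat_in_itvoo[q].
    rewrite in_itv/= => /andP[aq qg]; exists q => //; split => //.
    have [_ _ _ E] := HF q.
    have : ([set x | ratr q < g x] `\` (F q).2) x.
      by split => // xF; apply: Nx; exists q.
    by rewrite E => -[].
  move=> [q /= aq [Fx Nx]]; split => //=; rewrite in_itv/= andbT.
  have [_ _ _ E] := HF q.
  have : ((F q).1 `\` (F q).2) x.
    by split => // xF; apply: Nx; exists q.
  by rewrite -E => -[/= qg _]; exact: lt_trans qg.
rewrite bigcup_mkcond; apply: bigcupT_measurable_rat => q.
case: ifP => // _; apply: measurableD => //; by have [] := HF q.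
Qed.

End completion.

(** * Measurability in a compact metric group *)

Section metric.
Context {R : realType} {G : metricGroupType R}.
Implicit Types (x y z : G) (r : R) (U : set G).

Lemma in_ball x y r : ball x r y = (mdist x y < r).
Proof. by rewrite ballEmdist. Qed.

Lemma open_ball x r : open (ball x r : set G).
Proof.
rewrite openE => y; rewrite in_ball => xy; apply/nbhs_ballP.
exists (r - mdist x y); first by rewrite /= subr_gt0.
move=> z; rewrite !in_ball => yz.
by rewrite (le_lt_trans (metric_triangle _ y _))// -ltrBrDl.
Qed.

Lemma borel_open U : open U -> measurable (U : set (borel G)).
Proof. exact: sub_sigma_algebra. Qed.

Lemma borel_ball x r : measurable (ball x r : set (borel G)).
Proof. by apply: borel_open; exact: open_ball. Qed.

Lemma borel_closed U : closed U -> measurable (U : set (borel G)).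
Proof.
move=> cU; rewrite -[U]setCK; apply: measurableC.
by apply: borel_open; rewrite openC.
Qed.

Lemma borel_continuous (f : G -> G) : continuous f ->
  measurable_fun setT (f : borel G -> borel G).
Proof.
move=> /continuousP cf; apply: (@measurability _ _ _ (borel G) _ _ (@open G)); first by [].
by move=> _ [U oU <-]; rewrite setTI; by apply: borel_open; exact: cf.
Qed.

Hypothesis compactG : compact [set: G].

Definition dense_seq (e : nat -> G) :=
  forall x r, 0 < r -> exists n, ball x r (e n).

Lemma exists_dense_seq : exists e, dense_seq e.
Proof.
have [B /countable_injP[f finj] [_ Bb]] := compact_second_countable compactG.
pose e n : G := get [set x | exists b, [/\ B b, f b = n & b x]].
exists e => x r r0.
have [b [Bb1 bx] br] := Bb x _ (nbhsx_ballx x r r0).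
exists (f b); apply: br.
have : [set x | exists b', [/\ B b', f b' = f b & b' x]] (e (f b)).
  by apply: (@getPex _ [set x | exists b', [/\ B b', f b' = f b & b' x]]); exists x, b.
move=> [b' [Bb' /finj bb']].
by rewrite -bb' ?inE.
Qed.

Lemma exists_invSn_lt r : 0 < r -> exists n, n.+1%:R^-1 < r.
Proof. by move=> r0; have [n] := ltr_add_invr r0; rewrite add0r => ?; exists n. Qed.

(** [{(x, y) | mdist x y < r}] is open in the product, and by separability
    it is a countable union of products of balls. *)
Lemma measurable_mdist_lt r :
  measurable [set p : borel G * borel G | mdist (p.1 : G) (p.2 : G) < r].
Proof.
have [e he] := exists_dense_seq.
rewrite (_ : [set p | _] = \bigcup_n \bigcup_m
   ((ball (e n) m.+1%:R^-1 : set (borel G)) `*`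
    (ball (e n) (r - m.+1%:R^-1) : set (borel G)))).
  apply: bigcupT_measurable => n; apply: bigcupT_measurable => m.
  by apply: measurableX; exact: borel_ball.
apply/seteqP; split => [[x y]/= xy|[x y] [n _ [m _ /=]]].
  have [|m hm] := @exists_invSn_lt ((r - mdist (x : G) (y : G)) / 2).
    by rewrite divr_gt0// subr_gt0.
  have [|n hn] := he x m.+1%:R^-1; first by rewrite invr_gt0.
  exists n => //; exists m => //=; move: hn; rewrite !in_ball metric_sym => hn.
  split => //; have := @metric_triangle R G (e n) x y.
  move: hm hn; set a := mdist x y; set b := mdist (e n) x; set c := mdist (e n) y.
  by move: (m.+1%:R^-1) a b c => t a b c ? ? ?; lra.
rewrite !in_ball metric_sym => -[h1 h2].
move: h1 h2 (@metric_triangle R G x (e n) y).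
  by move: (m.+1%:R^-1) => t ? ? ?; lra.
Qed.

Definition closed_ball_of x r : set G := [set y | mdist x y <= r].

Lemma compact_closed_ball_of x r : compact (closed_ball_of x r).
Proof.
apply: (@subclosed_compact _ _ setT) => //.
rewrite -[closed_ball_of _ _]setCK; apply: open_closedC; rewrite openE.
move=> y /= /negP; rewrite -ltNge => xy; apply/nbhs_ballP.
exists (mdist x y - r); first by rewrite /= subr_gt0.
move=> z; rewrite in_ball => yz; rewrite /closed_ball_of /= => xz.
by have := metric_triangle x z y; rewrite (metric_sym z); lra.
Qed.

(** A family [phi] of continuous maps that is measurable for the compact-open
    topology is jointly measurable: [phi z x] is in an open set [U] iff some
    compact ball around [x] from a countable list is mapped into [U]. *)
Lemma measurable_evaluation {d} {Z : measurableType d} (phi : Z -> G -> G) :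
  (forall z : Z, continuous (phi z)) ->
  (forall K U, compact K -> open U -> measurable [set z : Z | phi z @` K `<=` U]) ->
  measurable_fun setT (fun p : Z * borel G => phi p.1 p.2 : borel G).
Proof.
move=> cphi mphi; have [e he] := exists_dense_seq.
apply: (@measurability _ _ _ (borel G) _ _ (@open G)); first by [].
move=> _ [U oU <-]; rewrite setTI.
rewrite (_ : _ @^-1` U = \bigcup_n \bigcup_m
   ([set z : Z | phi z @` closed_ball_of (e n) m.+1%:R^-1 `<=` U] `*`
    (ball (e n) m.+1%:R^-1 : set (borel G)))).
  apply: bigcupT_measurable => n; apply: bigcupT_measurable => m.
  apply: measurableX; last exact: borel_ball.
  by apply: mphi => //; exact: compact_closed_ball_of.
apply/seteqP; split => [[z x]/= Ux|[z x] [n _ [m _ /= [h1 h2]]]].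
  have : nbhs x (phi z @^-1` U) by apply: cphi; exact: open_nbhs_nbhs.
  move=> /nbhs_ballP[r /= r0 xr].
  have [|m hm] := @exists_invSn_lt (r / 2); first by rewrite divr_gt0.
  have [|n hn] := he x m.+1%:R^-1; first by rewrite invr_gt0.
  exists n => //; exists m => //=; move: hn; rewrite !in_ball metric_sym => hn.
  split => // _ [y ey <-]; apply: xr; rewrite in_ball.
  have := metric_triangle (x : G) (e n) (y : G); move: ey; rewrite /closed_ball_of /=.
  move: hm hn; rewrite (@metric_sym R G x (e n)).
  by move: (m.+1%:R^-1) => t ? ? ? ?; lra.
apply: h1; exists x => //; move: h2; rewrite in_ball /closed_ball_of /=; exact: ltW.
Qed.

End metric.

(** * Automorphisms preserve Haar measure *)

Lemma integralZ_indic {d} {T : measurableType d} {R : realType}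
    (m : {measure set T -> \bar R}) (c : \bar R) (D : set T) :
  (0 <= c)%E -> measurable D ->
  (\int[m]_y (c * (\1_D y : R)%:E) = c * m D)%E.
Proof.
move=> c0 mD; rewrite ge0_integralZl//.
- by rewrite integral_indic// setIT.
- by apply/measurable_EFinP; exact: measurable_indic.
Qed.

Section uniformly_distributed.
Context {R : realType} {G : metricGroupType R}.
Hypothesis compactG : compact [set: G].
Implicit Types m : {finite_measure set (borel G) -> \bar R}.

Definition uniformly_distributed m :=
  forall (x y : G) (r : R), m (ball x r) = m (ball y r).

(** Tonelli for the indicator of [{(x, y) | x \in D, mdist x y < r}]: the
    sections have mass [m2 (ball x r)] and at most [m1 (ball y r)]. *)
Lemma uniformly_distributed_le m1 m2 (D E : set (borel G)) (x0 : G) (r : R) :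
  uniformly_distributed m1 -> uniformly_distributed m2 ->
  measurable D -> measurable E ->
  (forall x y : G, D x -> mdist x y < r -> E y) ->
  (m1 D * m2 (ball x0 r) <= m2 E * m1 (ball x0 r))%E.
Proof.
move=> u1 u2 mD mE DE.
pose S := (D `*` setT) `&` [set p : borel G * borel G | mdist (p.1 : G) (p.2 : G) < r].
have mS : measurable S.
  apply: measurableI; last exact: (measurable_mdist_lt compactG).
  exact: measurableX.
pose Bl (x : borel G) : set (borel G) := ball (x : G) r.
have mB x : measurable (Bl x) by exact: borel_ball.
have B1 x : m1 (Bl x) = m1 (ball x0 r) by exact: u1.
have B2 x : m2 (Bl x) = m2 (ball x0 r) by exact: u2.
have f0 (p : borel G * borel G) : (0 <= ((\1_S p : R)%:E))%E by rewrite lee_fin.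
have mf : measurable_fun setT (fun p : borel G * borel G => (\1_S p : R)%:E).
  by apply/measurable_EFinP; exact: measurable_indic.
have I2 x : (\int[m2]_y ((\1_D x : R)%:E * (\1_(Bl x) y : R)%:E) =
    m2 (ball x0 r) * (\1_D x : R)%:E)%E.
  by rewrite -(B2 x) muleC; apply: integralZ_indic => //; rewrite lee_fin.
have I1 y : (\int[m1]_x ((\1_E y : R)%:E * (\1_(Bl y) x : R)%:E) =
    m1 (ball x0 r) * (\1_E y : R)%:E)%E.
  by rewrite -(B1 y) muleC; apply: integralZ_indic => //; rewrite lee_fin.
have := @fubini_tonelli _ _ _ _ _ m1 m2 _ mf f0.
have -> : (\int[m1]_x \int[m2]_y ((\1_S (x, y) : R)%:E) =
           m1 D * m2 (ball x0 r))%E.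
  rewrite muleC; transitivity (\int[m1]_x (m2 (ball x0 r) * (\1_D x : R)%:E))%E.
    apply: eq_integral => x _; rewrite -I2; apply: eq_integral => y _.
    rewrite -EFinM !indicE -natrM mulnb; congr (_%:R%:E).
    rewrite /S in_setI in_setX in_setT andbT/=; congr (_ && _); apply/idP/idP;
        by rewrite !inE /Bl /= ?in_ball.
  exact: integralZ_indic.
move=> ->.
have -> : (m2 E * m1 (ball x0 r) = \int[m2]_y \int[m1]_x
     ((\1_E y : R)%:E * (\1_(Bl y) x : R)%:E))%E.
  rewrite muleC; transitivity (\int[m2]_y (m1 (ball x0 r) * (\1_E y : R)%:E))%E.
    by apply/esym; exact: integralZ_indic.
  by apply: eq_integral => y _; rewrite I1.
have mE1 : measurable_fun setT (fun y : borel G => (m1 (ball x0 r) * (\1_E y : R)%:E)%E).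
  by apply: measurable_funeM; apply/measurable_EFinP; exact: measurable_indic.
apply: ge0_le_integral => //.
- by move=> y _; apply: integral_ge0.
- exact: (@measurable_fun_fubini_tonelli_G _ _ _ _ _ m1 (fun p => (\1_S p : R)%:E)).
- apply: eq_measurable_fun mE1 => y _.
  by rewrite I1.
- move=> y _; apply: ge0_le_integral => //.
  + exact: (measurableT_comp mf (measurable_pair2 y)).
  + by apply: measurable_funeM; apply/measurable_EFinP; exact: measurable_indic.
  move=> x _; rewrite -EFinM lee_fin !indicE -natrM mulnb ler_nat.
  have [|//] := boolP ((x, y) \in S).
  rewrite inE => -[[/= Dx _] xy].
  by rewrite !mem_set//= /Bl ?in_ball 1?metric_sym//; exact: DE Dx xy.
Qed.

(** With [D] and [E] the whole space, [uniformly_distributed_le] for the two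
    orders of the measures shows that [m1] and [m2] give the same mass to balls
    of the same radius.  With [E = U] and [D] the set of the points whose ball of
    radius [r] lies in [U], it then gives [m1 D <= m2 U], and these [D] increase
    to [U] as [r] tends to [0]. *)
Lemma uniformly_distributed_open_le m1 m2 (U : set G) :
  uniformly_distributed m1 -> uniformly_distributed m2 ->
  (forall (x : G) (r : R), 0 < r -> (0 < m1 (ball x r))%E) ->
  m1 setT = m2 setT -> open U -> (m1 U <= m2 U)%E.
Proof.
move=> u1 u2 pos mass oU.
pose x0 : G := point.
have fin1 (B : set (borel G)) : measurable B -> m1 B \is a fin_num.
  exact: fin_num_measure.
have massE (r : R) : 0 < r -> m1 (ball x0 r) = m2 (ball x0 r).
  move=> r0; have mpos : (0 < m1 setT)%E.
    apply: lt_le_trans (pos x0 r r0) _; apply: le_measure; rewrite ?inE//.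
    exact: borel_ball.
  have mB : measurable (ball x0 r : set (borel G)) by exact: borel_ball.
  have h1 := @uniformly_distributed_le m1 m2 setT setT x0 r u1 u2
     measurableT measurableT (fun _ _ _ _ => I).
  have h2 := @uniformly_distributed_le m2 m1 setT setT x0 r u2 u1
     measurableT measurableT (fun _ _ _ _ => I).
  rewrite -mass in h1 h2.
  apply/eqP; rewrite eq_le.
  by rewrite -(@lee_pmul2l _ (m1 setT))// ?fin1// h2 -(@lee_pmul2l _ (m1 setT))// ?fin1.
pose V n : set G := [set x | ball x n.+1%:R^-1 `<=` U].
have mV n : measurable (V n : set (borel G)).
  apply: borel_closed; rewrite -[V n]setCK; apply: open_closedC.
  rewrite (_ : ~` V n = \bigcup_(y in ~` U) ball y n.+1%:R^-1).
    by apply: bigcup_open => y _; exact: open_ball.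
  apply/seteqP; split => [x|x [y Uy xy]].
    move=> /existsNP[y /not_implyP[xy Uy]]; exists y => //; exact: ball_sym.
  by move=> /(_ y) xU; apply: Uy; apply: xU; exact: ball_sym.
have VU : \bigcup_n V n = U.
  apply/seteqP; split => [x [n _]|x Ux].
    by apply; apply: ballxx; rewrite invr_gt0.
  have : nbhs x U by exact: open_nbhs_nbhs.
  move=> /nbhs_ballP[r /= r0 xr]; have [n nr] := exists_invSn_lt r0.
  by exists n => // y xy; apply: xr; apply: le_ball xy; exact: ltW.
have cV : m1 \o V @ \oo --> m1 (\bigcup_n V n).
  apply: nondecreasing_cvg_mu => //.
  - by rewrite VU; exact: borel_open.
  - apply/nondecreasing_seqP => n; apply/subsetPset => x Vx y xy; apply: Vx.
    apply: le_ball xy; rewrite lef_pV2 ?posrE// ler_nat//.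
rewrite -[in leLHS]VU -(cvg_lim _ cV)//; apply: lime_le; first exact: cvgP cV.
apply: nearW => n /=.
have r0 : 0 < n.+1%:R^-1 :> R by rewrite invr_gt0.
have mU : measurable (U : set (borel G)) by exact: borel_open.
have := @uniformly_distributed_le m1 m2 (V n) U x0 n.+1%:R^-1 u1 u2 (mV n) mU.
rewrite -massE// => /(_ _)/wrap[x y Vx xy|].
  by apply: Vx; rewrite in_ball.
rewrite lee_pmul2r//; last exact: pos.
by apply: fin1; exact: borel_ball.
Qed.

(** Christensen's uniqueness theorem, in the compact case where the two measures
    can be compared on the whole space: they agree on open sets, which are stable
    under intersection and generate the Borel sets. *)
Lemma uniformly_distributed_unique m1 m2 :
  uniformly_distributed m1 -> uniformly_distributed m2 ->
  (forall (x : G) (r : R), 0 < r -> (0 < m1 (ball x r))%E) ->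
  (forall (x : G) (r : R), 0 < r -> (0 < m2 (ball x r))%E) ->
  m1 setT = m2 setT ->
  forall B : set (borel G), measurable B -> m1 B = m2 B.
Proof.
move=> u1 u2 pos1 pos2 mass B mB.
apply: (@measure_unique _ _ (borel G) (@open G) (fun=> setT)) => //.
- by move=> U V oU oV; exact: openI.
- by move=> _; exact: openT.
- by apply/seteqP; split => // x _; exists 0%N.
- by move=> U oU; apply/eqP; rewrite eq_le !uniformly_distributed_open_le.
- by move=> _; rewrite ltey_eq fin_num_measure.
Qed.

End uniformly_distributed.

Section haar.
Context {R : realType} {G : metricGroupType R}.
Hypothesis compactG : compact [set: G].
Hypothesis invG : left_invariant_metric G.
Variable mu : {measure set (borel G) -> \bar R}.
Hypothesis haar_mu : haar_measure mu.

Lemma haar_lty : (mu setT < +oo)%E.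
Proof. by have [_ + _ _ _] := haar_mu; exact. Qed.

Lemma left_mul_ball (g x : G) (r : R) :
  [set (g * z)%g | z in ball x r] = ball (g * x)%g r.
Proof.
apply/seteqP; split => [_ [z xz <-]|z]; first by move: xz; rewrite !in_ball invG.
rewrite in_ball => gz; exists (g^-1 * z)%g; last by rewrite mulVKg.
by rewrite in_ball -(invG g) mulVKg.
Qed.

Lemma haar_ball (x y : G) (r : R) : mu (ball x r) = mu (ball y r).
Proof.
have [inv _ _ _ _] := haar_mu.
rewrite -(inv (y * x^-1)%g (ball x r)); last exact: borel_ball.
by rewrite left_mul_ball mulgVK.
Qed.

(** Otherwise the countably many translates of a null ball that are centred at a
    dense sequence would cover the group. *)
Lemma haar_ball_gt0 (x : G) (r : R) : 0 < r -> (0 < mu (ball x r))%E.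
Proof.
move=> r0; rewrite lt_neqAle measure_ge0 andbT; apply/eqP => /esym x0.
have [_ _ _ _ /eqP] := haar_mu; apply.
have [e he] := exists_dense_seq compactG.
have mE n : measurable (ball (e n) r : set (borel G)) by exact: borel_ball.
apply/eqP; rewrite -measure_le0.
apply: (@le_trans _ _ (\sum_(0 <= n <oo) mu (ball (e n) r))%E).
  apply: measure_sigma_subadditive => //.
  move=> y _; have [n hn] := he y _ r0; exists n => //; exact: ball_sym.
by rewrite eseries0// => n _ _; rewrite (haar_ball _ x).
Qed.

(** The push-forward of [mu] under [phi] is again uniformly distributed, since
    [phi] carries left translations to left translations. *)
Lemma automorphism_haar (phi : automorphism G) (B : set (borel G)) :
  measurable B -> mu (phi @^-1` B) = mu B.
Proof.
move=> mB; have [psi [phiK psiK cphi cpsi]] := aut_homeo phi.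
have mphi : measurable_fun setT (phi : borel G -> borel G).
  exact: borel_continuous.
pose nu : {measure set (borel G) -> \bar R} :=
  measure_function_pushforward__canonical__measure_function_Measure mu mphi.
have nufin : (nu setT < +oo)%E by exact: haar_lty.
have cpre (x : G) (r : R) : open (phi @^-1` ball x r).
  by move/continuousP : cphi; apply; exact: open_ball.
have nu_pos (x : G) (r : R) : 0 < r -> (0 < nu (ball x r))%E.
  move=> r0; have : nbhs (psi x) (phi @^-1` ball x r).
    apply: open_nbhs_nbhs; split; first exact: cpre.
    by rewrite /= psiK; exact: ballxx.
  move=> /nbhs_ballP[e /= e0 se].
  apply: (lt_le_trans (haar_ball_gt0 (psi x) e0)); apply: le_measure => //;
    rewrite ?inE; first exact: borel_ball.
  by apply: borel_open; exact: cpre.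
have nu_unif : uniformly_distributed (finite_copy nufin).
  move=> x y r.
  have [inv _ _ _ _] := haar_mu.
  have -> : ball y r = [set (y * x^-1 * z)%g | z in ball x r].
    by rewrite left_mul_ball mulgVK.
  rewrite -[LHS](inv (psi (y * x^-1)%g)); last first.
    by apply: borel_open; exact: cpre.
  congr (mu _); apply/seteqP; split => z /=.
    by move=> [w xw <-]; exists (phi w) => //; rewrite aut_mul psiK.
  move=> [w xw wz]; exists (psi w); first by rewrite /= psiK.
  by apply: (can_inj phiK); rewrite aut_mul !psiK.
apply: (@uniformly_distributed_unique _ _ compactG (finite_copy nufin)
  (finite_copy haar_lty)) => //.
- by move=> x y r; exact: haar_ball.
- by move=> x r; exact: haar_ball_gt0.
Qed.

End haar.

(** * Growth of balls under the doubling condition *)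

Section doubling.
Context {R : realType} {G : metricGroupType R}.
Hypothesis compactG : compact [set: G].
Hypothesis invG : left_invariant_metric G.
Variable mu : {measure set (borel G) -> \bar R}.
Hypothesis haar_mu : haar_measure mu.
Hypothesis homG : homogeneous_type mu.

Local Notation Cmu := (doubling_constant mu).

(** The common mass of the balls of radius [r], by left invariance. *)
Definition ball_mass (r : R) : R := fine (mu (ball (point : G) r)).

Lemma haar_ballE (x : G) (r : R) : mu (ball x r) = (ball_mass r)%:E.
Proof.
rewrite /ball_mass (haar_ball invG haar_mu x point) fineK//.
apply: (finite_fin_num_fun (haar_lty compactG haar_mu)); exact: borel_ball.
Qed.

Lemma ball_mass_gt0 (r : R) : 0 < r -> 0 < ball_mass r.
Proof.
by move=> r0; rewrite -lte_fin -(haar_ballE point); exact: haar_ball_gt0.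
Qed.

Lemma ball_mass_ge0 (r : R) : 0 <= ball_mass r.
Proof. by rewrite -lee_fin -(haar_ballE point). Qed.

Lemma doublingP (C : R) : doubling mu C <->
  forall r, 0 < r -> ball_mass (2 * r) <= C * ball_mass r.
Proof.
split=> [dC r r0|dC x r r0]; last by rewrite !haar_ballE -EFinM lee_fin dC.
by have := dC point r r0; rewrite !haar_ballE -EFinM lee_fin.
Qed.

Let admissible := [set C : R | 1 <= C /\ doubling mu C].

Let admissible_inf : has_inf admissible.
Proof.
split; last by exists 1 => C [].
have [C /doublingP dC] := homG; exists (Num.max C 1); split.
  by rewrite le_max lexx orbT.
apply/doublingP => r r0; apply: le_trans (dC r r0) _.
by rewrite ler_wpM2r ?ball_mass_ge0// le_max lexx.
Qed.

Lemma doubling_constant_ge1 : 1 <= Cmu.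
Proof. by apply: lb_le_inf => [|C []//]; case: admissible_inf. Qed.

Lemma doubling_doubling_constant (r : R) : 0 < r ->
  ball_mass (2 * r) <= Cmu * ball_mass r.
Proof.
move=> r0; rewrite -ler_pdivrMr ?ball_mass_gt0//.
apply: lb_le_inf => [|C [_ /doublingP dC]]; first by case: admissible_inf.
by rewrite ler_pdivrMr ?ball_mass_gt0// dC.
Qed.

Lemma doubling_iter (n : nat) (r : R) : 0 < r ->
  ball_mass (2 ^+ n * r) <= Cmu ^+ n * ball_mass r.
Proof.
move=> r0; elim: n => [|n IH]; first by rewrite !expr0 !mul1r.
rewrite exprS -mulrA; apply: le_trans (doubling_doubling_constant _) _.
  by rewrite mulr_gt0// exprn_gt0.
rewrite exprS -mulrA ler_wpM2l// (le_trans _ doubling_constant_ge1)//.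
Qed.

Lemma le_ball_mass (r r' : R) : r <= r' -> ball_mass r <= ball_mass r'.
Proof.
move=> rr'; rewrite -lee_fin -!(haar_ballE point).
by apply: le_measure; rewrite ?inE; [exact: borel_ball..|exact: le_ball].
Qed.

(** An automorphism that pulls every ball back into a strictly smaller one
    preserves Haar measure, so all balls have the same mass. *)
Lemma doubling_constant_contracting (phi : automorphism G) (k : R) :
  0 < k < 1 ->
  (forall (x : G) (r : R), 0 < r -> exists x', phi @^-1` ball x r `<=` ball x' (k * r)) ->
  Cmu = 1.
Proof.
move=> /andP[k0 k1] kphi; apply/eqP; rewrite eq_le doubling_constant_ge1 andbT.
apply: inf_lbound; first by exists 1 => C [].
split => //; apply/doublingP => r r0; rewrite mul1r.
have contract (t : R) : 0 < t -> ball_mass t <= ball_mass (k * t).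
  move=> t0; have [x' hx'] := kphi point t t0.
  rewrite -lee_fin -(haar_ballE point) -(haar_ballE x').
  rewrite -(automorphism_haar compactG invG haar_mu phi); last exact: borel_ball.
  apply: le_measure => //; rewrite ?inE; last exact: borel_ball.
  apply: borel_open; have [_ [_ _ + _]] := aut_homeo phi.
  by move/continuousP; apply; exact: open_ball.
(* From radius [2 * r], contracting by [k] often enough goes below [r]. *)
have iter n : ball_mass (2 * r) <= ball_mass (k ^+ n * (2 * r)).
  elim: n => [|n IH]; first by rewrite expr0 mul1r.
  apply: le_trans IH _; rewrite exprS -mulrA; apply: contract.
  by rewrite !mulr_gt0// exprn_gt0.
have [n hn] : exists n, k ^+ n < 2^-1.
  have kn : `|k| < 1 by rewrite ger0_norm// ltW.
  have := cvg_expr kn => /cvgrPdist_lt/(_ 2^-1).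
  rewrite invr_gt0 => /(_ (ltr0n _ 2))[n _ hn]; exists n.
  have := hn n (leqnn n); rewrite /= sub0r normrN => /(le_lt_trans (ler_norm _)).
  by [].
apply: le_trans (iter n) _; apply: le_ball_mass.
rewrite mulrA ger_pMl// ltW// -ltr_pdivlMr// mul1r//.
Qed.

(** [n] is the least natural number with [k < 2 ^ n]. *)
Definition dyadic_level (n : nat) (k : R) :=
  k < 2 ^+ n /\ (forall m, n = m.+1 -> 2 ^+ m <= k).

Lemma exists_dyadic_level (k : R) : exists n, dyadic_level n k.
Proof.
have ex : exists n, k < 2 ^+ n.
  have [n kn] : exists n : nat, k < n%:R.
    by exists (Num.bound `|k|); exact: le_lt_trans (ler_norm _) (archi_boundP (normr_ge0 _)).
  exists n; apply: lt_trans kn _; rewrite -natrX ltr_nat; exact: ltn_expl.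
case: (ex_minnP ex) => n kn nmin; exists n; split => // m nm.
by rewrite leNgt; apply/negP => /nmin; rewrite nm ltnn.
Qed.

(** [Cmu ^ m <= k ^ s] as soon as [2 ^ m <= k], because [2 ^ s = Cmu]; at level
    [n] this is used for [m = n - 1], whence the factor [Cmu].  At level [0] both
    sides are equal to [1]. *)
Lemma dyadic_level_bound (n : nat) (k : R) : 0 < k ->
  dyadic_level n k -> (k < 1 -> Cmu = 1) ->
  Cmu ^+ n <= Cmu * k `^ (ln Cmu / ln 2).
Proof.
move=> k0 [kn nk] k1.
have C1 := doubling_constant_ge1.
have C0 : 0 < Cmu by apply: lt_le_trans C1.
case: n kn nk => [|n] kn nk.
  by rewrite k1 ?ln1 ?mul0r ?powRr0 ?expr0 ?mulr1.
rewrite exprS ler_wpM2l ?(ltW C0)//.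
have ln2 : 0 < ln 2 :> R by rewrite ln_gt0// ltr1n.
apply: (@le_trans _ _ ((2 ^+ n) `^ (ln Cmu / ln 2))).
  have E : 2 `^ (ln Cmu / ln 2) = Cmu :> R.
    by rewrite /powR pnatr_eq0/= divfK ?gt_eqF// lnK.
  by rewrite -(@powR_mulrn _ 2)// -powRrM mulrC powRrM E powR_mulrn// ltW.
apply: ge0_ler_powR; rewrite ?nnegrE ?exprn_ge0 ?(ltW k0)//; last exact: nk.
by apply: divr_ge0; [exact: ln_ge0|exact: ltW].
Qed.

End doubling.

(** * Jointly measurable families of measure preserving maps *)

(** Two sigma-algebras are needed: [Y] is to be the group with its Borel sets,
    [X] the same group with the completed sigma-algebra, [inc] the identity and
    [act u] the automorphism [A u]. *)
Section measure_preserving_family.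
Context {dX dY : measure_display} {X : measurableType dX} {Y : measurableType dY}.
Context {R : realType}.
Variable P : {finite_measure set X -> \bar R}.
Variables (inc : X -> Y) (act : X -> X -> Y).
Hypothesis minc : measurable_fun setT inc.
Hypothesis mact : measurable_fun setT (fun p : X * X => act p.1 p.2).
Hypothesis act_preserves :
  forall u B, measurable B -> P (act u @^-1` B) = P (inc @^-1` B).

Lemma measurable_act (u : X) : measurable_fun setT (act u).
Proof. exact: (measurableT_comp mact (measurable_pair1 u)). Qed.

Lemma ge0_integral_act (u : X) (h : Y -> \bar R) :
  measurable_fun setT h -> (forall y, 0 <= h y)%E ->
  (\int[P]_x h (act u x) = \int[P]_x h (inc x))%E.
Proof.
move=> mh h0.
transitivity (\int[pushforward P (act u)]_y h y)%E.
  by rewrite ge0_integral_pushforward//; exact: measurable_act.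
transitivity (\int[pushforward P inc]_y h y)%E; last first.
  by rewrite ge0_integral_pushforward.
pose image (f : X -> Y) (mf : measurable_fun setT f) :=
  measure_function_pushforward__canonical__measure_function_Measure P mf.
apply: (@eq_measure_integral _ _ _ _ (image _ minc) (image _ (measurable_act u))).
by move=> B mB _; exact: act_preserves.
Qed.

Lemma Rintegral_act (u : X) (h : Y -> R) : measurable_fun setT h ->
  \int[P]_x h (act u x) = \int[P]_x h (inc x).
Proof.
move=> mh; rewrite /Rintegral; congr fine.
have mh' : measurable_fun setT (EFin \o h) by exact/measurable_EFinP.
rewrite [LHS]integralE [RHS]integralE; congr (_ - _)%E.
  transitivity (\int[P]_x (EFin \o h)^\+ (act u x))%E.
    by apply: eq_integral => x _; rewrite !funeposE.
  rewrite ge0_integral_act//; last exact: measurable_funepos.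
  by apply: eq_integral => x _; rewrite !funeposE.
transitivity (\int[P]_x (EFin \o h)^\- (act u x))%E.
  by apply: eq_integral => x _; rewrite !funenegE.
rewrite ge0_integral_act//; last exact: measurable_funeneg.
by apply: eq_integral => x _; rewrite !funenegE.
Qed.

Lemma integral_complex_act (u : X) (f : Y -> R[i]) : measurable_complex f ->
  integral_complex P (fun x => f (act u x)) =
  integral_complex P (fun x => f (inc x)).
Proof.
move=> [f1 f2]; congr Complex.
  exact: (@Rintegral_act u (fun y => complex.Re (f y))).
exact: (@Rintegral_act u (fun y => complex.Im (f y))).
Qed.

(** By Tonelli for the indicator of [{(u, x) | N (act u x)}], all of whose
    sections at fixed [u] are null. *)
Lemma ae_act_null (N : set Y) : measurable N -> P (inc @^-1` N) = 0%E ->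
  {ae P, forall x, {ae P, forall u, ~ N (act u x)}}.
Proof.
move=> mN N0.
pose S : set (X * X) := (fun p => act p.1 p.2) @^-1` N.
have mS : measurable S by rewrite -[S]setTI; exact: mact.
have f0 (p : X * X) : (0 <= ((\1_S p : R)%:E))%E by rewrite lee_fin.
have mf : measurable_fun setT (fun p : X * X => (\1_S p : R)%:E).
  by apply/measurable_EFinP; exact: measurable_indic.
have sec (x : X) : measurable [set u | N (act u x)].
  have := measurableT_comp mact (measurable_pair2 x).
  by move=> /(_ measurableT N mN); rewrite setTI.
have := @fubini_tonelli _ _ _ _ _ P P _ mf f0.
have -> : (\int[P]_u \int[P]_x ((\1_S (u, x) : R)%:E) = 0)%E.
  apply: integral0_eq => u _.
  rewrite -[RHS]N0 -(act_preserves u mN).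
  transitivity (\int[P]_x ((\1_(act u @^-1` N) x : R)%:E))%E; first by [].
  rewrite integral_indic// ?setIT//; rewrite -[X in measurable X]setTI.
  exact: measurable_act.
move=> /esym.
have -> : (\int[P]_x \int[P]_u ((\1_S (u, x) : R)%:E) =
   \int[P]_x P [set u | N (act u x)])%E.
  apply: eq_integral => x _.
  transitivity (\int[P]_u ((\1_[set u | N (act u x)] u : R)%:E))%E; first by [].
  by rewrite integral_indic// setIT.
have mG : measurable_fun setT (fun x => P [set u | N (act u x)]).
  apply: eq_measurable_fun
    (@measurable_fun_fubini_tonelli_G _ _ _ _ _ P _ mf f0) => x _.
  rewrite /fubini_G; transitivity (\int[P]_u ((\1_[set u | N (act u x)] u : R)%:E))%E; first by [].
  by rewrite integral_indic// setIT.
move=> G0; have := (ae_eq_integral_abs P measurableT mG).1.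
move=> /(_ _)/wrap[|].
  by etransitivity; [|exact: G0]; apply: eq_integral => x _; rewrite gee0_abs.
apply: filterS => x /(_ I) Px.
exists [set u | N (act u x)]; split => //.
by move=> u /= /contrapT.
Qed.

Lemma ae_act (Q : Y -> Prop) :
  (exists N, [/\ measurable N, P (inc @^-1` N) = 0%E & ~` Q `<=` N]) ->
  {ae P, forall x, {ae P, forall u, Q (act u x)}}.
Proof.
move=> [N [mN N0 QN]]; apply: filterS (ae_act_null mN N0) => x.
by apply: filterS => u Nu; apply: contrapT => /QN.
Qed.

Section kernel.
Variable K : X * Y -> R[i].
Hypothesis mK : measurable_complex K.

Lemma measurable_kernel_act :
  measurable_complex (fun p : X * X => K (p.1, act p.1 p.2)).
Proof.
apply: (measurable_complex_comp _ mK).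
by apply: measurable_fun_pair => //; exact: measurable_fst.
Qed.

Lemma integral_kernel_act :
  (\int[P]_u \int[P]_x (cabs (K (u, act u x)))%:E =
   \int[P]_u \int[P]_x (cabs (K (u, inc x)))%:E)%E.
Proof.
apply: eq_integral => u _; apply: (ge0_integral_act u (h := fun y => (cabs (K (u, y)))%:E)).
  by apply: measurable_cabse; exact: measurable_complex_pair1.
by move=> y; rewrite lee_fin cabs_ge0.
Qed.

(** The Hausdorff operator is the case of [K (u, y) = Phi u * f y]. *)
Definition superposition (x : X) : R[i] :=
  integral_complex P (fun u => K (u, act u x)).

Lemma measurable_superposition : measurable_complex superposition.
Proof. exact: (measurable_fubini_complex P measurable_kernel_act). Qed.

Lemma superposition_L1 :
  (\int[P]_x (cabs (superposition x))%:E <=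
   \int[P]_u \int[P]_x (cabs (K (u, inc x)))%:E)%E.
Proof.
rewrite -integral_kernel_act.
exact: (minkowski_integral P P measurable_kernel_act).
Qed.

Hypothesis Koo : (\int[P]_u \int[P]_x (cabs (K (u, inc x)))%:E < +oo)%E.

Lemma ae_integrable_superposition :
  {ae P, forall x, integrable_complex P (fun u => K (u, act u x))}.
Proof.
apply: (ae_integrable_complex measurable_kernel_act).
by rewrite integral_kernel_act.
Qed.

(** Fubini, and invariance of the measure in the inner integral. *)
Lemma integral_superposition :
  integral_complex P superposition =
  integral_complex P (fun u => integral_complex P (fun x => K (u, inc x))).
Proof.
have KAoo : (\int[P]_u \int[P]_x (cabs (K (u, act u x)))%:E < +oo)%E.
  by rewrite integral_kernel_act.
rewrite (fubini_complex measurable_kernel_act KAoo).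
congr integral_complex; apply/funext => u.
apply: (@integral_complex_act u (fun y => K (u, y))).
exact: measurable_complex_pair1.
Qed.

End kernel.

End measure_preserving_family.

(** * Absolutely summable series in L^1 *)

Section series_L1.
Context {d : measure_display} {X : measurableType d} {R : realType}.
Variable P : {measure set X -> \bar R}.

Lemma cvge0P (u : nat -> \bar R) : (forall n, 0 <= u n)%E ->
  (u @ \oo --> 0%E) <->
  (forall e : R, 0 < e -> exists N, forall n, (N <= n)%N -> (u n <= e%:E)%E).
Proof.
move=> u0; split=> [/fine_cvgP[ufin /cvgrPdist_lt uc] e e0|H].
  have := uc e e0 => ucn.
  have [N _ HN] : \forall n \near \oo, (u n <= e%:E)%E.
    near=> n; have un : u n \is a fin_num by near: n.
    have : `|0 - fine (u n)| < e by near: n.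
    rewrite sub0r normrN => h; rewrite -(fineK un) lee_fin.
    exact: le_trans (ler_norm _) (ltW h).
  by exists N => n Nn; exact: HN.
apply/fine_cvgP; split.
  have [N HN] := H 1 ltr01; exists N => // n /= Nn.
  by rewrite ge0_fin_numE// (le_lt_trans (HN n Nn))// ltry.
apply/cvgrPdist_le => e e0; have [N HN] := H e e0; exists N => // n /= Nn.
have un : u n \is a fin_num by rewrite ge0_fin_numE// (le_lt_trans (HN n Nn))// ltry.
by rewrite sub0r normrN ger0_norm ?fine_ge0// -lee_fin fineK// HN.
Unshelve. all: by end_near. Qed.

Lemma L1_triangle (f g : X -> R[i]) : measurable_complex f -> measurable_complex g ->
  (\int[P]_x (cabs (f x - g x))%:E <=
   \int[P]_x (cabs (f x))%:E + \int[P]_x (cabs (g x))%:E)%E.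
Proof.
move=> mf mg; rewrite -ge0_integralD//; first apply: ge0_le_integral => //.
- by move=> x _; rewrite lee_fin cabs_ge0.
- by apply: measurable_cabse; exact: measurable_complexB.
- by apply: emeasurable_funD; exact: measurable_cabse.
- by move=> x _; rewrite -EFinD lee_fin cabsB.
- by move=> x _; rewrite lee_fin cabs_ge0.
- exact: measurable_cabse.
- by move=> x _; rewrite lee_fin cabs_ge0.
- exact: measurable_cabse.
Qed.

Lemma L1_sum_le (s : seq nat) (c : nat -> R[i]) (b : nat -> X -> R[i]) :
  (forall j, measurable_complex (b j)) ->
  (forall j, \int[P]_x (cabs (b j x))%:E <= 1)%E ->
  (\int[P]_x (cabs (\sum_(j <- s) c j * b j x))%:E <= \sum_(j <- s) (cabs (c j))%:E)%E.
Proof.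
move=> mb b1.
have mcb j : measurable_complex (fun x => c j * b j x).
  by apply: measurable_complexM => //; exact: measurable_complex_cst.
apply: (@le_trans _ _ (\int[P]_x \sum_(j <- s) (cabs (c j) * cabs (b j x))%:E)%E).
  apply: ge0_le_integral => //.
  - by move=> x _; rewrite lee_fin cabs_ge0.
  - by apply: measurable_cabse; exact: measurable_complex_sum.
  - apply: emeasurable_sum => j; under eq_fun do rewrite -cabsM.
    exact: measurable_cabse.
  - move=> x _; rewrite sumEFin lee_fin (le_trans (cabs_sum _ _ _))//.
    by apply: ler_sum => j _; rewrite cabsM.
rewrite ge0_integral_sum//.
- apply: lee_sum => j _; under eq_integral do rewrite EFinM.
  rewrite ge0_integralZl//.
  + rewrite -[leRHS]mule1; apply: lee_wpmul2l => //; rewrite lee_fin cabs_ge0//.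
  + exact: measurable_cabse.
  + by move=> x _; rewrite lee_fin cabs_ge0.
  + by rewrite lee_fin cabs_ge0.
- move=> j; under eq_fun do rewrite -cabsM; exact: measurable_cabse.
- by move=> j x _; rewrite lee_fin mulr_ge0 ?cabs_ge0.
Qed.

Lemma L1_le_indic (f : X -> R[i]) (D : set X) (c : R) : measurable_complex f ->
  measurable D -> 0 <= c -> (forall x, cabs (f x) <= c * \1_D x) ->
  (\int[P]_x (cabs (f x))%:E <= c%:E * P D)%E.
Proof.
move=> mf mD c0 fc; rewrite -integralZ_indic ?lee_fin//.
apply: ge0_le_integral => //.
- by move=> x _; rewrite lee_fin cabs_ge0.
- exact: measurable_cabse.
- by apply: measurable_funeM; apply/measurable_EFinP; exact: measurable_indic.
- by move=> x _; rewrite -EFinM lee_fin.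
Qed.

Lemma L1_set_lty (f : X -> R[i]) (E : set X) : measurable_complex f ->
  measurable E -> (\int[P]_x (cabs (f x))%:E < +oo)%E ->
  (\int[P]_(x in E) (cabs (f x))%:E < +oo)%E.
Proof.
move=> mf mE; apply: le_lt_trans; apply: ge0_subset_integral => //.
- exact: measurable_cabse.
- by move=> u _; rewrite lee_fin cabs_ge0.
Qed.

Lemma L1_set_le (f : X -> R[i]) (E : set X) (c : R) (w : X -> R) :
  measurable_complex f -> measurable E -> measurable_fun setT w -> 0 <= c ->
  (forall x, E x -> c * cabs (f x) <= w x) ->
  (c%:E * \int[P]_(x in E) (cabs (f x))%:E <= \int[P]_(x in E) (w x)%:E)%E.
Proof.
move=> mf mE mw c0 cw; have mc := measurable_funTS (measurable_cabse mf).
rewrite -ge0_integralZl//; last by move=> u _; rewrite lee_fin cabs_ge0.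
apply: ge0_le_integral => //.
- by move=> u _; rewrite -EFinM lee_fin mulr_ge0 ?cabs_ge0.
- exact: measurable_funeM.
- by apply: measurable_funTS; exact/measurable_EFinP.
Qed.

Lemma uniq_sum_le_tail (a : nat -> R) (s : seq nat) (J : nat) :
  (forall j, 0 <= a j) -> uniq s -> {in s, forall j, (J <= j)%N} ->
  (\sum_(j <- s) (a j)%:E <= \sum_(J <= j <oo) (a j)%:E)%E.
Proof.
move=> a0 us sJ.
pose M := (\max_(j <- s) j.+1)%N.
have sM j : j \in s -> (j < M)%N.
  by move=> js; rewrite /M (big_rem j)//= leq_max ltnSn.
apply: (@le_trans _ _ (\sum_(J <= j < M) (a j)%:E)%E); last first.
  by apply: nneseries_lim_ge => j _ _; rewrite lee_fin.
have ps : perm_eq s [seq j <- index_iota J M | j \in s].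
  apply: uniq_perm => //; first by rewrite filter_uniq// iota_uniq.
  move=> j; rewrite mem_filter mem_index_iota.
  by case: (boolP (j \in s)) => //= js; rewrite sJ//= sM.
rewrite (perm_big _ ps) big_filter [leRHS](bigID (mem s))/=.
by rewrite leeDl// sume_ge0// => j _; rewrite lee_fin.
Qed.

(** Once [s n] contains all the indices below [J], the sum over [s n] differs
    from the partial sum up to [J] by terms of the tail. *)
Lemma rearranged_series_cvg (g : X -> R[i]) (c : nat -> R[i]) (b : nat -> X -> R[i])
    (s : nat -> seq nat) :
  measurable_complex g -> (forall j, measurable_complex (b j)) ->
  (forall j, \int[P]_x (cabs (b j x))%:E <= 1)%E ->
  (\sum_(0 <= j <oo) (cabs (c j))%:E < +oo)%E ->
  (fun n => \int[P]_x (cabs (g x - \sum_(j < n) c j * b j x))%:E)%E @ \oo --> 0%E ->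
  (forall n, uniq (s n)) ->
  (forall j, exists N, forall n, (N <= n)%N -> j \in s n) ->
  (fun n => \int[P]_x (cabs (g x - \sum_(j <- s n) c j * b j x))%:E)%E @ \oo --> 0%E.
Proof.
move=> mg mb b1 cS gc us sall.
have int0 (h : X -> R[i]) : (0 <= \int[P]_x (cabs (h x))%:E)%E.
  by apply: integral_ge0 => x _; rewrite lee_fin cabs_ge0.
have mcb j : measurable_complex (fun x => c j * b j x).
  by apply: measurable_complexM => //; exact: measurable_complex_cst.
move/cvge0P : gc => /(_ (fun=> int0 _)) gc.
have /cvge0P tc : (fun N => \sum_(N <= j <oo) (cabs (c j))%:E)%E @ \oo --> 0%E.
  by apply: nneseries_tail_cvg => // j _; rewrite lee_fin cabs_ge0.
have /tc {}tc N : (0 <= \sum_(N <= j <oo) (cabs (c j))%:E)%E.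
  by apply: nneseries_ge0 => j _ _; rewrite lee_fin cabs_ge0.
apply/cvge0P => // e e0.
have e2 : 0 < e / 2 by rewrite divr_gt0.
have [J1 HJ1] := gc _ e2; have [J2 HJ2] := tc _ e2.
(* Beyond [J] the terms have total mass at most [e / 2], and so does the error of
   the partial sum up to [J]. *)
pose J := maxn J1 J2.
have [N HN] : exists N, forall n, (N <= n)%N -> {subset iota 0 J <= s n}.
  elim: J => [|J [N HN]]; first by exists 0%N.
  have [N' HN'] := sall J; exists (maxn N N') => n; rewrite geq_max => /andP[h1 h2] j.
  by rewrite mem_iota/= add0n ltnS leq_eqVlt => /orP[/eqP->|jJ];
    [exact: HN'|apply: HN => //; rewrite mem_iota].
exists N => n Nn.
pose t := [seq j <- s n | (J <= j)%N].
have perm_s : perm_eq (s n) (iota 0 J ++ t).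
  apply: uniq_perm => //.
    rewrite cat_uniq iota_uniq filter_uniq// andbT/=; apply/hasPn => j.
    by rewrite mem_filter mem_iota/= add0n => /andP[]; rewrite leqNgt.
  move=> j; rewrite mem_cat mem_filter mem_iota/= add0n.
  case: (ltnP j J) => jJ /=; last by [].
  by rewrite (HN n Nn)// mem_iota.
have E x : g x - \sum_(j <- s n) c j * b j x =
    (g x - \sum_(j < J) c j * b j x) - \sum_(j <- t) c j * b j x.
  rewrite (perm_big _ perm_s) big_cat/= opprD addrA; congr (_ - _ - _).
  by rewrite -[J in iota 0 J]subn0 -/(index_iota 0 J) big_mkord.
under eq_integral do rewrite E.
apply: (le_trans (L1_triangle _ _)).
- by apply: measurable_complexB => //; exact: measurable_complex_sum.
- exact: measurable_complex_sum.
rewrite [e]splitr EFinD; apply: leeD; first by apply: HJ1; rewrite leq_maxl.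
apply: (le_trans (L1_sum_le _ _ _ _)) => //.
apply: (le_trans (@uniq_sum_le_tail _ _ J2 _ _ _)).
- by move=> j; exact: cabs_ge0.
- exact: filter_uniq.
- by move=> j; rewrite mem_filter => /andP[+ _]; apply: leq_trans; rewrite leq_maxr.
exact: HJ2.
Qed.

End series_L1.

(** * Superpositions of a series of functions *)

Section superposed_series.
Context {dX dY : measure_display} {X : measurableType dX} {Y : measurableType dY}.
Context {R : realType}.
Variable P : {finite_measure set X -> \bar R}.
Variables (inc : X -> Y) (act : X -> X -> Y).
Hypothesis minc : measurable_fun setT inc.
Hypothesis mact : measurable_fun setT (fun p : X * X => act p.1 p.2).
Hypothesis act_preserves :
  forall u B, measurable B -> P (act u @^-1` B) = P (inc @^-1` B).
Variable Phi : X -> R[i].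
Hypothesis mPhi : measurable_complex Phi.

Lemma measurable_product_kernel (g : Y -> R[i]) : measurable_complex g ->
  measurable_complex (fun p : X * Y => Phi p.1 * g p.2).
Proof.
move=> mg; apply: measurable_complexM.
  exact: measurable_complex_comp measurable_fst mPhi.
exact: measurable_complex_comp measurable_snd mg.
Qed.

Lemma product_kernel_L1 (g : Y -> R[i]) : measurable_complex g ->
  (\int[P]_u \int[P]_x (cabs (Phi u * g (inc x)))%:E =
   (\int[P]_u (cabs (Phi u))%:E) * (\int[P]_x (cabs (g (inc x)))%:E))%E.
Proof.
move=> mg.
have mgi : measurable_complex (fun x => g (inc x)) by exact: measurable_complex_comp minc mg.
rewrite muleC -ge0_integralZl//.
- apply: eq_integral => u _; rewrite muleC -ge0_integralZl//.
  + by apply: eq_integral => x _; rewrite cabsM EFinM.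
  + exact: measurable_cabse.
  + by move=> x _; rewrite lee_fin cabs_ge0.
  + by rewrite lee_fin cabs_ge0.
- exact: measurable_cabse.
- by move=> x _; rewrite lee_fin cabs_ge0.
- by apply: integral_ge0 => x _; rewrite lee_fin cabs_ge0.
Qed.

(** The term [c j * a j] of a series is cut into pieces: the piece [m] belongs to
    the term [term_of m], and it only keeps the parameters in [E m].  The two
    hypotheses on [E] say that for each [j] the sets [E m] with [term_of m = j]
    partition the parameters. *)
Variables (c : nat -> R[i]) (term_of : nat -> nat) (E : nat -> set X).
Hypothesis mE : forall m, measurable (E m).
Hypothesis E_inj : forall u m m', E m u -> E m' u -> term_of m = term_of m' -> m = m'.
Hypothesis E_all : forall u j, exists2 m, E m u & term_of m = j.
Hypothesis cS : (\sum_(0 <= j <oo) (cabs (c j))%:E < +oo)%E.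

Local Notation Lambda := (\sum_(0 <= j <oo) (cabs (c j))%:E)%E.

(* The terms selected by the parameter [u] among the first [n] pieces. *)
Let s (u : X) (n : nat) : seq nat := [seq term_of m | m <- seq.iota 0 n & u \in E m].

Let s_uniq u n : uniq (s u n).
Proof.
rewrite map_inj_in_uniq ?filter_uniq ?iota_uniq// => m m'.
rewrite !mem_filter => /andP[/set_mem Em _] /andP[/set_mem Em' _].
exact: E_inj Em Em'.
Qed.

Let s_all u j : exists N, forall n, (N <= n)%N -> j \in s u n.
Proof.
have [m Em <-] := E_all u j; exists m.+1 => n mn; apply: map_f.
by rewrite mem_filter mem_iota/= add0n mn andbT mem_set.
Qed.

Let sum_s (V : nmodType) (F : nat -> V) u n :
  \sum_(j <- s u n) F j = \sum_(m < n) (if u \in E m then F (term_of m) else 0).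
Proof.
by rewrite /s big_map big_filter -[n in LHS]subn0 -/(index_iota 0 n) big_mkord big_mkcond.
Qed.

(** The terms selected by a given [u] are distinct, so that the sum of their
    [|c j|] is at most [Lambda]. *)
Lemma superposed_coef_sum_le (w : X -> R) (n : nat) :
  measurable_fun setT w -> (forall u, 0 <= w u) ->
  (\sum_(m < n) ((cabs (c (term_of m)))%:E * \int[P]_(u in E m) (w u)%:E) <=
   Lambda * \int[P]_u (w u)%:E)%E.
Proof.
move=> mw w0.
have mwE : measurable_fun setT (fun u => (w u)%:E) by exact/measurable_EFinP.
have mF m : measurable_fun setT (fun u => (cabs (c (term_of m)))%:E * ((w u)%:E * (\1_(E m) u)%:E))%E.
  apply: measurable_funeM; apply: emeasurable_funM => //.
  by apply/measurable_EFinP; exact: measurable_indic.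
have F0 m u : (0 <= (cabs (c (term_of m)))%:E * ((w u)%:E * (\1_(E m) u)%:E))%E.
  by rewrite -!EFinM lee_fin !mulr_ge0 ?cabs_ge0.
have -> : (\sum_(m < n) ((cabs (c (term_of m)))%:E * \int[P]_(u in E m) (w u)%:E) =
  \int[P]_u \sum_(m < n) ((cabs (c (term_of m)))%:E * ((w u)%:E * (\1_(E m) u)%:E)))%E.
  rewrite ge0_integral_sum//; apply: eq_bigr => m _.
  rewrite ge0_integralZl//; last 3 first.
  - apply: emeasurable_funM => //.
    by apply/measurable_EFinP; exact: measurable_indic.
  - by move=> u _; rewrite -EFinM lee_fin mulr_ge0.
  - by rewrite lee_fin cabs_ge0.
  congr (_ * _)%E; rewrite [LHS]integral_mkcond; apply: eq_integral => u _.
  by rewrite epatch_indic.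
rewrite -ge0_integralZl//; last 2 first.
- by move=> u _; rewrite lee_fin.
- by apply: nneseries_ge0 => j _ _; rewrite lee_fin cabs_ge0.
apply: ge0_le_integral => //.
- by move=> u _; apply: sume_ge0.
- exact: emeasurable_sum.
- exact: measurable_funeM.
move=> u _.
have -> : (\sum_(m < n) (cabs (c (term_of m)))%:E * ((w u)%:E * (\1_(E m) u)%:E) =
   \sum_(j <- s u n) ((cabs (c j))%:E * (w u)%:E))%E.
  rewrite sum_s; apply: eq_bigr => m _; rewrite indicE.
  by case: (u \in E m); rewrite ?mule1 ?mule0.
rewrite -ge0_sume_distrl; last by move=> j _; rewrite lee_fin cabs_ge0.
apply: lee_wpmul2r; first by rewrite lee_fin.
by apply: uniq_sum_le_tail => // j; exact: cabs_ge0.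
Qed.

Variables (f : Y -> R[i]) (a : nat -> Y -> R[i]).
Hypothesis Phi1 : (\int[P]_u (cabs (Phi u))%:E < +oo)%E.
Hypothesis mf : measurable_complex f.
Hypothesis f1 : (\int[P]_x (cabs (f (inc x)))%:E < +oo)%E.
Hypothesis ma : forall j, measurable_complex (a j).
Hypothesis a1 : forall j, (\int[P]_x (cabs (a j (inc x)))%:E <= 1)%E.
Hypothesis fa : (fun n => \int[P]_x
  (cabs (f (inc x) - \sum_(j < n) c j * a j (inc x)))%:E)%E @ \oo --> 0%E.

Definition piece_kernel (m : nat) (p : X * Y) : R[i] :=
  ((\1_(E m) p.1 : R)%:C)%C * Phi p.1 * a (term_of m) p.2.

Lemma measurable_piece_kernel m : measurable_complex (piece_kernel m).
Proof.
apply: measurable_complexM.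
  have mEP : measurable_complex (fun u => ((\1_(E m) u : R)%:C)%C * Phi u).
    by apply: measurable_complexM => //; exact: measurable_complex_indic.
  exact: measurable_complex_comp measurable_fst mEP.
exact: measurable_complex_comp measurable_snd (ma _).
Qed.

Lemma cabs_piece_kernel m (p : X * Y) :
  cabs (piece_kernel m p) = \1_(E m) p.1 * cabs (Phi p.1) * cabs (a (term_of m) p.2).
Proof. by rewrite !cabsM cabs_real ger0_norm. Qed.

Let minca j : measurable_complex (fun x => a j (inc x)).
Proof. exact: measurable_complex_comp minc (ma j). Qed.

Let mincf : measurable_complex (fun x => f (inc x)).
Proof. exact: measurable_complex_comp minc mf. Qed.

Lemma piece_kernel_lty m :
  (\int[P]_u \int[P]_x (cabs (piece_kernel m (u, inc x)))%:E < +oo)%E.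
Proof.
apply: le_lt_trans Phi1; apply: ge0_le_integral => //.
- by move=> u _; apply: integral_ge0 => x _; rewrite lee_fin cabs_ge0.
- apply: (@measurable_fubini_cabs _ _ _ _ _ P (fun p => piece_kernel m (p.1, inc p.2))).
  apply: measurable_complex_comp (measurable_piece_kernel m).
  by apply: measurable_fun_pair => //; exact: measurableT_comp minc measurable_snd.
- exact: measurable_cabse.
move=> u _; under eq_integral do rewrite cabs_piece_kernel EFinM /=.
rewrite ge0_integralZl//; last 3 first.
- exact: measurable_cabse.
- by move=> x _; rewrite lee_fin cabs_ge0.
- by rewrite lee_fin mulr_ge0 ?cabs_ge0.
rewrite -[leRHS]mule1; apply: lee_pmul => //.
- by rewrite lee_fin mulr_ge0 ?cabs_ge0.
- by apply: integral_ge0 => x _; rewrite lee_fin cabs_ge0.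
by rewrite lee_fin ler_piMl ?cabs_ge0// indicE lern1 leq_b1.
Qed.

Lemma cabs_superposed_piece_le m (b : R) (x : X) : 0 <= b ->
  (forall y, cabs (a (term_of m) y) <= b) ->
  ((cabs (superposition P act (piece_kernel m) x))%:E <=
   b%:E * \int[P]_(u in E m) (cabs (Phi u))%:E)%E.
Proof.
move=> b0 ab.
have mKA := measurable_kernel_act mact (measurable_piece_kernel m).
have mKx := measurable_complex_pair2 x mKA.
apply: (le_trans (cabs_integral_complex P mKx)).
have mw : measurable_fun setT (fun u : X => ((cabs (Phi u))%:E * (\1_(E m) u : R)%:E)%E).
  apply: emeasurable_funM; first exact: measurable_cabse.
  by apply/measurable_EFinP; exact: measurable_indic.
have -> : (\int[P]_(u in E m) (cabs (Phi u))%:E =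
    \int[P]_u ((cabs (Phi u))%:E * (\1_(E m) u : R)%:E))%E.
  by rewrite [LHS]integral_mkcond; apply: eq_integral => u _; rewrite epatch_indic.
rewrite -ge0_integralZl//; last by move=> u _; rewrite -EFinM lee_fin mulr_ge0 ?cabs_ge0.
apply: ge0_le_integral => //.
- by move=> u _; rewrite lee_fin cabs_ge0.
- exact: measurable_cabse.
- exact: measurable_funeM.
move=> u _; rewrite cabs_piece_kernel/= -!EFinM lee_fin.
rewrite mulrC [X in _ <= _ * X]mulrC.
by apply: ler_wpM2r; [rewrite mulr_ge0 ?cabs_ge0|exact: ab].
Qed.

Lemma superposed_piece_L1 m :
  (\int[P]_x (cabs (superposition P act (piece_kernel m) x))%:E < +oo)%E.
Proof.
exact: le_lt_trans
  (superposition_L1 minc mact act_preserves (measurable_piece_kernel m))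
  (piece_kernel_lty m).
Qed.

Lemma integral_superposed_piece m :
  integral_complex P (fun x => a (term_of m) (inc x)) = 0 ->
  integral_complex P (superposition P act (piece_kernel m)) = 0.
Proof.
move=> int0; rewrite (integral_superposition minc mact act_preserves
  (measurable_piece_kernel m) (piece_kernel_lty m)).
rewrite (_ : (fun u => integral_complex P _) = fun=> 0) ?integral_complex0//.
apply/funext => u; transitivity (((\1_(E m) u : R)%:C)%C * Phi u *
    integral_complex P (fun x => a (term_of m) (inc x))); last by rewrite int0 mulr0.
have ia : integrable_complex P (fun x => a (term_of m) (inc x)).
  apply/integrable_complexP; split; first exact: minca.
  by apply: le_lt_trans (a1 _) _; rewrite ltry.
exact (integral_complexZ (((\1_(E m) u : R)%:C)%C * Phi u) ia).
Qed.

Lemma product_kernel_lty :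
  (\int[P]_u \int[P]_x (cabs (Phi u * f (inc x)))%:E < +oo)%E.
Proof.
rewrite product_kernel_L1//; apply: lte_mul_pinfty => //.
  by apply: integral_ge0 => x _; rewrite lee_fin cabs_ge0.
by rewrite ge0_fin_numE//; apply: integral_ge0 => x _; rewrite lee_fin cabs_ge0.
Qed.

(** The error is the superposition of the kernels
    [Phi u * (f - sum of the c_j a_j selected by u)], and for each [u] the
    selected terms are a rearrangement of a partial sum of the series of [f];
    dominated convergence in [u] concludes. *)
Lemma superposed_series_cvg :
  (fun n => \int[P]_x (cabs (
      integral_complex P (fun u => Phi u * f (act u x)) -
      \sum_(m < n) c (term_of m) * superposition P act (piece_kernel m) x))%:E)%E
    @ \oo --> 0%E.
Proof.
pose K n (p : X * Y) := Phi p.1 * (f p.2 - \sum_(j <- s p.1 n) c j * a j p.2).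
(* The terms selected by [p.1] are the pieces whose indicator is [1] there. *)
have KE n p : K n p = Phi p.1 * f p.2 - \sum_(m < n) c (term_of m) * piece_kernel m p.
  rewrite /K mulrBr sum_s mulr_sumr; congr (_ - _); apply: eq_bigr => m _.
  rewrite /piece_kernel indicE; case: (p.1 \in E m) => /=.
    by rewrite mul1r mulrCA.
  by rewrite !mul0r !mulr0.
have mK n : measurable_complex (K n).
  rewrite (funext (KE n)); apply: measurable_complexB; first exact: measurable_product_kernel.
  apply: measurable_complex_sum => m; apply: measurable_complexM.
    exact: measurable_complex_cst.
  exact: measurable_piece_kernel.
pose D n u := (\int[P]_x (cabs (f (inc x) - \sum_(j <- s u n) c j * a j (inc x)))%:E)%E.
have D0 n u : (0 <= D n u)%E by apply: integral_ge0 => x _; rewrite lee_fin cabs_ge0.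
have mS u n : measurable_complex (fun x => \sum_(j <- s u n) c j * a j (inc x)).
  apply: measurable_complex_sum => j; apply: measurable_complexM.
    exact: measurable_complex_cst.
  exact: minca.
have DE n u : (\int[P]_x (cabs (K n (u, inc x)))%:E = (cabs (Phi u))%:E * D n u)%E.
  rewrite -ge0_integralZl//; last 3 first.
  - by apply: measurable_cabse; exact: measurable_complexB.
  - by move=> x _; rewrite lee_fin cabs_ge0.
  - by rewrite lee_fin cabs_ge0.
  by apply: eq_integral => x _; rewrite cabsM EFinM.
pose B := (\int[P]_x (cabs (f (inc x)))%:E + Lambda)%E.
have B0 : (0 <= B)%E.
  apply: adde_ge0; first by apply: integral_ge0 => x _; rewrite lee_fin cabs_ge0.
  by apply: nneseries_ge0 => j _ _; rewrite lee_fin cabs_ge0.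
have Bfin : B \is a fin_num by rewrite ge0_fin_numE// lte_add_pinfty.
have DB n u : (D n u <= B)%E.
  apply: (le_trans (L1_triangle _ mincf (mS u n))); apply: leeD => //.
  apply: (le_trans (L1_sum_le _ _ minca a1)).
  by apply: uniq_sum_le_tail => // j; exact: cabs_ge0.
have Dcvg u : (D ^~ u) @ \oo --> 0%E.
  by apply: rearranged_series_cvg => //.
have mKD n : measurable_fun setT (fun u => (cabs (Phi u))%:E * D n u)%E.
  rewrite (_ : (fun u => _) = (fun u => \int[P]_x (cabs (K n (u, inc x)))%:E)%E); last first.
    by apply/funext => u; rewrite DE.
  apply: (@measurable_fubini_cabs _ _ _ _ _ P (fun p => K n (p.1, inc p.2))).
  apply: measurable_complex_comp (mK n).
  by apply: measurable_fun_pair => //; exact: measurableT_comp minc measurable_snd.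
have iD : (fun n => \int[P]_u ((cabs (Phi u))%:E * D n u))%E @ \oo --> (\int[P]_u cst 0 u)%E.
  have [] := @dominated_convergence _ _ _ P setT measurableT
    (fun n u => (cabs (Phi u))%:E * D n u)%E (cst 0%E)
    (fun u => (cabs (Phi u))%:E * B)%E mKD (measurable_cst _).
  - apply: aeW => u _ /=; rewrite -[X in _ --> X](mule0 (cabs (Phi u))%:E).
    exact: cvgeZl.
  - apply/integrableP; split.
      rewrite -(fineK Bfin); apply: emeasurable_funM => //; exact: measurable_cabse.
    under eq_integral do rewrite gee0_abs ?mule_ge0 ?lee_fin ?cabs_ge0// muleC.
    rewrite ge0_integralZl//; last 2 first.
    - exact: measurable_cabse.
    - by move=> x _; rewrite lee_fin cabs_ge0.
    by apply: lte_mul_pinfty.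
  - apply: aeW => u n _; rewrite gee0_abs ?mule_ge0 ?lee_fin ?cabs_ge0//.
    by apply: lee_wpmul2l => //; rewrite lee_fin cabs_ge0.
  by [].
rewrite integral0 in iD.
apply: (@squeeze_cvge _ _ _ _ (cst 0%E) _ _ _ _ (cvg_cst _) iD).
apply: nearW => n; apply/andP; split.
  by apply: integral_ge0 => x _; rewrite lee_fin cabs_ge0.
under [leRHS]eq_integral do rewrite -DE.
apply: le_trans (superposition_L1 minc mact act_preserves (mK n)).
have mT : measurable_complex (fun x => integral_complex P (fun u => Phi u * f (act u x))).
  exact: (measurable_superposition P mact (measurable_product_kernel mf)).
have mpiece m : measurable_complex (superposition P act (piece_kernel m)).
  exact: (measurable_superposition P mact (measurable_piece_kernel m)).
rewrite le_eqVlt; apply/orP; left; apply/eqP; apply: ae_eq_integral => //.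
- apply: measurable_cabse; apply: measurable_complexB => //.
  apply: measurable_complex_sum => m; apply: measurable_complexM.
    exact: measurable_complex_cst.
  exact: mpiece.
- by apply: measurable_cabse; exact: (measurable_superposition P mact (mK n)).
have H1 := ae_integrable_superposition minc mact act_preserves
  (measurable_product_kernel mf) product_kernel_lty.
have H2 : {ae P, forall x, forall m, integrable_complex P
    (fun u => piece_kernel m (u, act u x))}.
  apply: ae_foralln => m.
  exact: (ae_integrable_superposition minc mact act_preserves
    (measurable_piece_kernel m) (piece_kernel_lty m)).
apply: filterS2 H1 H2 => x h1 h2 _; congr EFin; congr cabs.
rewrite /superposition.
have -> : (fun u => K n (u, act u x)) = (fun u => Phi u * f (act u x) -
    \sum_(m < n) c (term_of m) * piece_kernel m (u, act u x)).
  by apply/funext => u; rewrite KE.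
rewrite integral_complexB//; last first.
  by apply: integrable_complex_sum => m; exact: integrable_complexZ.
rewrite integral_complex_sum; last by move=> m; exact: integrable_complexZ.
by congr (_ - _); apply: eq_bigr => m _; rewrite integral_complexZ.
Qed.

End superposed_series.

(** * The action of the automorphisms *)

Section automorphism_action.
Context {R : realType} {G : metricGroupType R}.
Hypothesis compactG : compact [set: G].
Hypothesis invG : left_invariant_metric G.
Variable mu : {measure set (borel G) -> \bar R}.
Hypothesis haar_mu : haar_measure mu.
Variable A : G -> automorphism G.
Hypothesis mA : measurable_aut mu A.

Local Notation P := (finite_copy (completed_lty (haar_lty compactG haar_mu))).

(** The identity with its two types kept apart, so that the measurable structures
    of its domain and codomain can be inferred. *)
Definition identity_completed : completed_space mu -> borel G := id.

Definition aut_action : completed_space mu -> completed_space mu -> borel G :=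
  fun u x => A u x.

Lemma measurable_identity_completed : measurable_fun setT identity_completed.
Proof. by move=> _ B mB; rewrite setTI; exact: completed_measurable. Qed.

Lemma aut_continuous (phi : automorphism G) : continuous phi.
Proof. by have [_ [_ _ + _]] := aut_homeo phi. Qed.

Lemma measurable_aut_action :
  measurable_fun setT (fun p : completed_space mu * completed_space mu =>
    aut_action p.1 p.2).
Proof.
have mE : measurable_fun setT
    (fun p : completed_space mu * borel G => A p.1 p.2 : borel G).
  apply: (@measurable_evaluation _ _ compactG _ (completed_space mu)
    (fun u => A u : G -> G)) => [u|K U cK oU]; first exact: aut_continuous.
  exact: (mA (compact_open_open cK oU)).
apply: (measurableT_comp mE (g := fun p => (p.1, identity_completed p.2))).
apply: measurable_fun_pair; first exact: measurable_fst.
exact: (measurableT_comp measurable_identity_completed measurable_snd).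
Qed.

Lemma aut_action_preserves (u : completed_space mu) (B : set (borel G)) :
  measurable B -> P (aut_action u @^-1` B) = P (identity_completed @^-1` B).
Proof.
move=> mB; transitivity (mu (A u @^-1` B)).
  apply: completedE; rewrite -[X in measurable X]setTI.
  exact: (borel_continuous (@aut_continuous (A u))).
rewrite automorphism_haar//; apply/esym; exact: completedE.
Qed.

(** A single null set serves for the whole sequence, so that linear relations
    between its members hold outside of it. *)
Lemma borel_restriction (g : nat -> G -> R[i]) (Q : G -> Prop) :
  (forall i, cmeasurable mu (g i)) -> {ae completed mu, forall x, Q x} ->
  exists N : set (borel G), [/\ measurable N, mu N = 0%E, ~` N `<=` Q
    & forall i, measurable_complex (fun x : borel G => g i x * ((\1_(~` N) x : R)%:C)%C)].
Proof.
move=> mg Qae; have mufin := haar_lty compactG haar_mu.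
have [N0 [mN0 N00 QN]] := completed_null mufin Qae.
have [F1 HF1] := choice (fun i => completed_fun_version mufin (mg i).1).
have [F2 HF2] := choice (fun i => completed_fun_version mufin (mg i).2).
pose N := N0 `|` \bigcup_i (F1 i `|` F2 i).
have mN : measurable N.
  apply: measurableU => //; apply: bigcupT_measurable => i.
  by apply: measurableU; [have [] := HF1 i|have [] := HF2 i].
exists N; split => //.
- apply/(negligibleP mu mN); apply: negligibleU; first exact/negligibleP.
  apply: negligible_bigcup => i; apply: negligibleU; apply/negligibleP;
    by [have [] := HF1 i|have [] := HF2 i].
- by move=> x Nx; apply: contrapT => Qx; apply: Nx; left; exact: QN.
move=> i.
have [mF1 _ m1] := HF1 i; have [mF2 _ m2] := HF2 i.
have mC : measurable (~` N) by exact: measurableC.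
have restr (h : G -> R) (F : set (borel G)) : measurable F -> F `<=` N ->
    measurable_fun (~` F) (h : borel G -> R) ->
    measurable_fun setT (fun x : borel G => h x * \1_(~` N) x).
  move=> mF FN mh.
  have mhN : measurable_fun (~` N) (h : borel G -> R).
    apply: measurable_funS mh; first exact: measurableC.
    exact: subsetC.
  have := (measurable_restrict (h : borel G -> R) mC measurableT).1.
  rewrite setTI => /(_ mhN); congr measurable_fun; apply/funext => x.
  by rewrite patchE indicE; case: (x \in ~` N); rewrite ?mulr1 ?mulr0.
split.
  under eq_fun do rewrite complex_ReM /= mulr0 subr0.
  by apply: (restr _ _ mF1) => // x Fx; right; exists i => //; left.
under eq_fun do rewrite complex_ImM /= mulr0 add0r.
by apply: (restr _ _ mF2) => // x Fx; right; exists i => //; right.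
Qed.

End automorphism_action.

(** * Atoms and their Borel representatives *)

Section complete_measure.
Context {d : measure_display} {X : measurableType d} {R : realType}.
Variable m : {measure set X -> \bar R}.
Hypothesis cm : measure_is_complete m.
Implicit Types g h : X -> R[i].

Lemma ae_imply (Q Q' : X -> Prop) : (forall x, Q x -> Q' x) ->
  {ae m, forall x, Q x} -> {ae m, forall x, Q' x}.
Proof. by move=> QQ'; apply: filterS. Qed.

Lemma ae_imply2 (Q1 Q2 Q : X -> Prop) : (forall x, Q1 x -> Q2 x -> Q x) ->
  {ae m, forall x, Q1 x} -> {ae m, forall x, Q2 x} -> {ae m, forall x, Q x}.
Proof. by move=> h; apply: filterS2. Qed.

Lemma ae_eq_measurable_complex g h : {ae m, forall x, g x = h x} ->
  measurable_complex g -> measurable_complex h.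
Proof.
move=> gh [g1 g2]; split; apply/measurable_EFinP.
  apply: (ae_measurable_fun cm (f := EFin \o (fun x => complex.Re (g x)))).
    by apply: filterS gh => x /= ->.
  exact/measurable_EFinP.
apply: (ae_measurable_fun cm (f := EFin \o (fun x => complex.Im (g x)))).
  by apply: filterS gh => x /= ->.
exact/measurable_EFinP.
Qed.

Lemma ae_eq_L1 g h : measurable_complex g -> measurable_complex h ->
  {ae m, forall x, g x = h x} ->
  (\int[m]_x (cabs (g x))%:E = \int[m]_x (cabs (h x))%:E)%E.
Proof.
move=> mg mh gh; apply: ae_eq_integral => //; do ?exact: measurable_cabse.
by apply: filterS gh => x ->.
Qed.

Lemma ae_eq_integrable_complex g h : {ae m, forall x, g x = h x} ->
  integrable_complex m g -> integrable_complex m h.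
Proof.
move=> gh /integrable_complexP[mg ig]; apply/integrable_complexP.
have mh := ae_eq_measurable_complex gh mg.
by split=> //; rewrite -(ae_eq_L1 mg mh gh).
Qed.

Lemma ae_eq_integral_complex_complete g h : {ae m, forall x, g x = h x} ->
  measurable_complex g -> integral_complex m g = integral_complex m h.
Proof.
move=> gh mg; apply: ae_eq_integral_complex => //.
exact: ae_eq_measurable_complex gh mg.
Qed.

End complete_measure.

Section borel_atoms.
Context {R : realType} {G : metricGroupType R}.
Hypothesis compactG : compact [set: G].
Hypothesis invG : left_invariant_metric G.
Variable mu : {measure set (borel G) -> \bar R}.
Hypothesis haar_mu : haar_measure mu.

Local Notation X := (completed_space mu).
Local Notation P := (finite_copy (completed_lty (haar_lty compactG haar_mu))).

Lemma cintegralE (g : G -> R[i]) : cintegral mu g = integral_complex (completed mu) g.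
Proof. by []. Qed.

(** Every atom has a Borel representative of this kind, whose bound holds
    everywhere instead of almost everywhere. *)
Definition borel_atom (x : G) (r : R) (a : G -> R[i]) :=
  [/\ 0 < r, measurable_complex (a : borel G -> R[i]),
      forall y, a y != 0 -> ball x r y,
      forall y, cabs (a y) <= (ball_mass mu r)^-1
    & cintegral mu a = 0].

Lemma completed_measurable_complex (g : borel G -> R[i]) : measurable_complex g ->
  measurable_complex (g : X -> R[i]).
Proof. by move=> [g1 g2]; split; exact: measurable_fun_completed. Qed.

Lemma borel_atom_L1 (x : G) (r : R) (a : G -> R[i]) : borel_atom x r a ->
  (\int[P]_y (cabs (a y))%:E <= 1)%E.
Proof.
move=> [r0 ma supp bnd _].
have mB : measurable (ball x r : set (borel G)) by exact: borel_ball.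
have mB' : measurable (ball x r : set X) by exact: completed_measurable.
have m0 : 0 < ball_mass mu r by exact: ball_mass_gt0.
have PB : P (ball x r) = (ball_mass mu r)%:E.
  by transitivity (mu (ball x r)); [exact: completedE|exact: haar_ballE].
have c0 : 0 <= (ball_mass mu r)^-1 by rewrite invr_ge0 ltW.
have ac (z : X) : cabs (a z) <= (ball_mass mu r)^-1 * \1_(ball x r : set X) z.
  rewrite indicE; have [az|az] := eqVneq (a z) 0; first by rewrite az cabs0 mulr_ge0.
  by rewrite mem_set ?mulr1//; exact: supp.
apply: le_trans (L1_le_indic P (completed_measurable_complex ma) mB' c0 ac) _.
rewrite [X in (_ * X)%E]PB -EFinM mulVf// gt_eqF//.
Qed.

Lemma atom_ae_bound (a : G -> R[i]) (c : R) :
  ('N[completed mu]_+oo[EFin \o (cabs \o a)] <= c%:E)%E ->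
  {ae completed mu, forall x, cabs (a x) <= c}.
Proof.
rewrite unlock; case: ifPn => [_ /ess_supP|]; last first.
  rewrite -leNgt => mu0 _; have : (mu setT <= 0)%E.
    by apply: le_trans mu0; rewrite -(completedE mu measurableT).
  rewrite leNgt => /negP; case; rewrite lt_neqAle measure_ge0 andbT eq_sym.
  by have [] := haar_mu.
by apply: filterS => x; rewrite /= lee_fin ger0_norm ?cabs_ge0.
Qed.

Lemma atom_bound_intro (a : G -> R[i]) (c : R) : 0 <= c ->
  (forall x, cabs (a x) <= c) ->
  ('N[completed mu]_+oo[EFin \o (cabs \o a)] <= c%:E)%E.
Proof.
move=> c0 ac; rewrite unlock; case: ifPn => [_|_]; last by rewrite lee_fin.
apply/ess_supP; apply: aeW => x /=.
by rewrite lee_fin ger0_norm ?cabs_ge0.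
Qed.

(** Multiplying [f] and the atoms by the indicator of the complement of a common
    Borel null set makes them Borel and turns the almost sure bounds of the atoms
    into bounds; supports can only shrink, and integrals and [L^1] distances do
    not change. *)
Lemma borel_decomposition (f : G -> R[i]) (l : nat -> R[i]) (a : nat -> G -> R[i]) :
  cmeasurable mu f -> atomic_decomposition mu f l a ->
  exists (N : set (borel G)) (f' : G -> R[i]) (a' : nat -> G -> R[i])
    (x : nat -> G) (r : nat -> R),
  [/\ measurable N /\ mu N = 0%E,
      measurable_complex (f' : borel G -> R[i]),
      forall y, ~ N y -> f y = f' y,
      forall j, borel_atom (x j) (r j) (a' j)
    & (fun n => \int[P]_y (cabs (f' y - \sum_(j < n) l j * a' j y))%:E)%E
        @ \oo --> 0%E].
Proof.
move=> mf [at_a lS fa].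
have ma j : cmeasurable mu (a j) by have [] := at_a j.
have [x Hx] := choice (fun j => (at_a j).2).
have [r Hr] := choice Hx.
pose g i := if i is j.+1 then a j else f.
have mg i : cmeasurable mu (g i) by case: i.
pose Q y := forall j, cabs (a j y) <= (ball_mass mu (r j))^-1.
have aeQ : {ae completed mu, forall y, Q y}.
  apply: ae_foralln => j; have [_ _ + _] := Hr j => /atom_ae_bound.
  by rewrite (haar_ballE compactG invG haar_mu).
have [N [mN N0 NQ mgN]] := borel_restriction compactG haar_mu mg aeQ.
pose ind y : R[i] := ((\1_(~` N) y : R)%:C)%C.
have ind1 y : ~ N y -> ind y = 1 by move=> Ny; rewrite /ind indicE mem_set.
have ind0 y : N y -> ind y = 0.
  by move=> Ny; rewrite /ind indicE memNset.
have aeN : {ae (completed mu : {measure set X -> \bar R}), forall y, ~ N y}.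
  exists N; split; [exact: completed_measurable| |by move=> y /= /contrapT].
  by rewrite -[RHS]N0; exact: completedE.
have mX i : measurable_complex (fun y : X => g i y * ind y).
  exact: (completed_measurable_complex (mgN i)).
exists N, (fun y => f y * ind y), (fun j y => a j y * ind y), x, r; split => //.
- exact: (mgN 0%N).
- by move=> y Ny; rewrite ind1// mulr1.
- move=> j; have [r0 supp _ int0] := Hr j; split => //.
  + exact: (mgN j.+1).
  + by move=> y; rewrite mulf_eq0 negb_or => /andP[ay _]; exact: supp.
  + move=> y; rewrite cabsM; have [Ny|Ny] := pselect (N y).
      by rewrite ind0// cabs0 mulr0 invr_ge0 ball_mass_ge0.
    rewrite ind1// /cabs ComplexField.Normc.normc1 mulr1; exact: NQ.
  + transitivity (cintegral mu (a j)); last exact: int0.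
    rewrite !cintegralE; apply: (@ae_eq_integral_complex _ _ _ (completed mu)).
    * exact: (mX j.+1).
    * exact: ma.
    * by apply: (ae_imply _ aeN) => y Ny; rewrite ind1// mulr1.
- rewrite (_ : (fun n => _) = (fun n =>
    \int[P]_y (cabs (f y - \sum_(j < n) l j * a j y))%:E)%E)//.
  apply/funext => n; apply: (@ae_eq_L1 _ _ _ (completed mu)).
  + apply: measurable_complexB; first exact: (mX 0%N).
    apply: measurable_complex_sum => j; apply: measurable_complexM.
      exact: measurable_complex_cst.
    exact: (mX j.+1).
  + apply: measurable_complexB; first exact: mf.
    apply: measurable_complex_sum => j; apply: measurable_complexM.
      exact: measurable_complex_cst.
    exact: ma.
  + apply: (ae_imply _ aeN) => y Ny; rewrite ind1// mulr1; congr (_ - _).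
    by apply: eq_bigr => j _; rewrite mulr1.
Qed.

End borel_atoms.

(** * Superpositions of one atom over a cell of parameters *)

Section pieces.
Context {R : realType} {G : metricGroupType R}.
Hypothesis compactG : compact [set: G].
Hypothesis invG : left_invariant_metric G.
Variable mu : {measure set (borel G) -> \bar R}.
Hypothesis haar_mu : haar_measure mu.
Hypothesis homG : homogeneous_type mu.
Variable A : G -> automorphism G.
Hypothesis mA : measurable_aut mu A.
Variable k : G -> R.
Hypothesis k_gt0 : forall u, 0 < k u.
Hypothesis mk : measurable_fun [set: completed_space mu]
            (k : completed_space mu -> R).
Hypothesis kA : forall (u x : G) (r : R), 0 < r ->
       exists x' : G, A u @^-1` ball x r `<=` ball x' (k u * r).

Local Notation X := (completed_space mu).
Local Notation P := (finite_copy (completed_lty (haar_lty compactG haar_mu))).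
Local Notation Cmu := (doubling_constant mu).

(** While [u] varies in a cell, the supports of the functions [a (A u _)], for
    [a] an atom of the ball of [x] and [r], stay in one ball, of a size that
    [k u] controls; hence their superposition is a multiple of one atom. *)
Definition pullback_cell (x : G) (r : R) (y : G) (n : nat) : set X :=
  [set u | dyadic_level n (k u) /\ A u @^-1` ball x r `<=` ball y (2 ^+ n * r)].

(** The complement of the second condition is open for the compact-open
    topology: it says that some point outside of the ball of [y] is mapped into
    the ball of [x]. *)
Lemma measurable_pullback_cell x r y n : measurable (pullback_cell x r y n).
Proof.
apply: measurableI.
  have mlt : measurable ([set u | k u < 2 ^+ n] : set X).
    have := mk measurableT (measurable_itv `]-oo, (2 ^+ n : R)[).
    by rewrite setTI; congr measurable; apply/seteqP; split => u;
      rewrite /= in_itv.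
  case: n mlt => [|n] mlt.
    by move: mlt; congr measurable; apply/seteqP; split => [u /= ?|u /= []//]; split.
  have mge : measurable ([set u | 2 ^+ n <= k u] : set X).
    have := mk measurableT (measurable_itv `[(2 ^+ n : R), +oo[).
    by rewrite setTI; congr measurable; apply/seteqP; split => u;
      rewrite /= in_itv/= andbT.
  have := measurableI _ _ mlt mge; congr measurable; apply/seteqP; split => u /=.
    by move=> [h1 h2]; split => // m [<-].
  by move=> [h1 h2]; split => //; exact: h2.
rewrite -[X in measurable X]setCK; apply: measurableC.
pose V : set {compact-open, G -> G} :=
  \bigcup_(z in ~` ball y (2 ^+ n * r)) [set g | g @` [set z] `<=` ball x r].
have oV : open V.
  apply: bigcup_open => z _; apply: compact_open_open; first exact: compact_set1.
  exact: open_ball.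
have := mA oV; congr measurable; apply/seteqP; split => u /=.
  by move=> [z zy zx] /(_ z) yz; apply: zy; apply: yz; apply: zx; exists z.
move=> /existsNP[z /not_implyP[zx zy]]; exists z => // _ [_ -> <-].
exact: zx.
Qed.

(** Since [k u < 2 ^ n], the centre given by [kA] can be moved slightly, to a
    member of the dense sequence. *)
Lemma pullback_cell_cover (e : nat -> G) (x : G) (r : R) (u : X) :
  dense_seq e -> 0 < r -> exists n i, pullback_cell x r (e i) n u.
Proof.
move=> he r0; have [n kn] := exists_dyadic_level (k u).
have [x' xx'] := kA u x r0.
have gap : 0 < 2 ^+ n * r - k u * r by rewrite -mulrBl mulr_gt0// subr_gt0; case: kn.
have [i hi] := he x' _ gap; exists n, i; split => // z /xx'.
rewrite !in_ball => xz; move: hi; rewrite in_ball => hi.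
have := @metric_triangle R G (e i) x' z; rewrite (metric_sym (e i) x').
by move: xz hi; move: (mdist x' z) (mdist x' (e i)) (mdist (e i) z) => a b c; lra.
Qed.

Lemma pullback_cell_bound x r y n u : pullback_cell x r y n u ->
  Cmu ^+ n <= Cmu * k u `^ (ln Cmu / ln 2).
Proof.
move=> [kn _]; apply: (dyadic_level_bound compactG invG haar_mu homG) => // ku.
by apply: (doubling_constant_contracting compactG invG haar_mu homG
  (phi := A u) (k := k u)); [rewrite k_gt0|exact: kA].
Qed.

(** The natural number [m] encodes a term [j] and the number of a cell in a list
    of the cells for [x j] and [r j]; the cells of each list are made disjoint by
    removing the previous ones. *)
Lemma exists_pullback_partition (x : nat -> G) (r : nat -> R) :
  (forall j, 0 < r j) ->
  exists (term_of : nat -> nat) (E : nat -> set X) (y : nat -> G) (n : nat -> nat),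
  [/\ forall m, measurable (E m),
      forall u m m', E m u -> E m' u -> term_of m = term_of m' -> m = m',
      forall u j, exists2 m, E m u & term_of m = j
    & forall m, E m `<=` pullback_cell (x (term_of m)) (r (term_of m)) (y m) (n m)].
Proof.
move=> r0; have [e he] := exists_dense_seq compactG.
have /card_set_bijP[b [_ binj bsurj]] : ([set: nat] #= [set: nat * nat])%card.
  by rewrite card_eq_sym card_nat2.
pose D j q := pullback_cell (x j) (r j) (e (b q).2) (b q).1.
exists (fun m => (b m).1), (fun m => seqDU (D (b m).1) (b m).2),
  (fun m => e (b (b m).2).2), (fun m => (b (b m).2).1); split.
- move=> m; apply: seqDU_measurable => q; exact: measurable_pullback_cell.
- move=> u m m' Em Em' jj; apply: binj; rewrite ?inE//.
  rewrite (surjective_pairing (b m)) (surjective_pairing (b m')) jj; congr pair.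
  move: Em Em'; rewrite jj => Em Em'.
  apply: (@trivIset_seqDU _ (D (b m').1)) => //.
  by exists u.
- move=> u j.
  have : (\bigcup_q D j q) u.
    have [n [i ni]] := pullback_cell_cover (x j) u he (r0 j).
    have [q _ bq] := bsurj (n, i) I.
    by exists q => //; rewrite /D bq.
  rewrite seqDU_bigcup_eq => -[q _ Dq].
  by have [m _ bm] := bsurj (j, q) I; exists m; rewrite bm.
- by move=> m; exact: subset_seqDU.
Qed.

Variable Phi : G -> R[i].
Hypothesis mPhi : measurable_complex (Phi : X -> R[i]).
Hypothesis Phi1 : (\int[P]_u (cabs (Phi u))%:E < +oo)%E.

Definition piece (E : set X) (a : G -> R[i]) (x : G) : R[i] :=
  cintegral mu (fun u => ((\1_E u : R)%:C)%C * Phi u * a (A u x)).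

Definition piece_mass (E : set X) : R := fine (\int[P]_(u in E) (cabs (Phi u))%:E)%E.

Lemma piece_massE (E : set X) : measurable E ->
  (\int[P]_(u in E) (cabs (Phi u))%:E)%E = (piece_mass E)%:E.
Proof.
move=> mE; rewrite /piece_mass fineK// ge0_fin_numE; last first.
  by apply: integral_ge0 => u _; rewrite lee_fin cabs_ge0.
exact: (@L1_set_lty _ _ _ P (Phi : X -> R[i])).
Qed.

Lemma piece_mass_ge0 E : 0 <= piece_mass E.
Proof. by apply/fine_ge0/integral_ge0 => u _; rewrite lee_fin cabs_ge0. Qed.

Section one_piece.
Variables (x : G) (r : R) (a : G -> R[i]) (E : set X) (y : G) (n : nat).
Hypothesis at_a : borel_atom mu x r a.
Hypothesis mE : measurable E.
Hypothesis E_cell : E `<=` pullback_cell x r y n.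

Let ma : measurable_complex (a : borel G -> R[i]).
Proof. by have [] := at_a. Qed.

Let r0 : 0 < r. Proof. by have [] := at_a. Qed.

Let mact := measurable_aut_action compactG mA.
Let minc := @measurable_identity_completed R G mu.
Let pres := aut_action_preserves compactG invG haar_mu A.
Let a1 := borel_atom_L1 compactG invG haar_mu at_a.

Let K : X * borel G -> R[i] := piece_kernel (Phi : X -> R[i])
  (fun=> 0%N) (fun=> E) (fun=> a : borel G -> R[i]) 0%N.

Let pieceE : piece E a = superposition P (@aut_action _ _ mu A) K.
Proof. by []. Qed.

Let mpiece : measurable_complex (piece E a : X -> R[i]).
Proof.
exact: (measurable_superposition P mact (measurable_piece_kernel mPhi (fun=> 0%N)
  (fun=> mE) (fun=> ma) 0%N)).
Qed.

Let mass_gt0 : 0 < ball_mass mu r.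
Proof. exact: ball_mass_gt0. Qed.

Let mass2_gt0 : 0 < ball_mass mu (2 ^+ n * r).
Proof. by apply: ball_mass_gt0 => //; rewrite mulr_gt0// exprn_gt0. Qed.

Lemma cabs_piece_le z : cabs (piece E a z) <= (ball_mass mu r)^-1 * piece_mass E.
Proof.
have [_ _ _ abnd _] := at_a.
rewrite -lee_fin EFinM -piece_massE// pieceE.
apply: cabs_superposed_piece_le => //.
by rewrite invr_ge0 ltW.
Qed.

Lemma piece_support z : piece E a z != 0 -> ball y (2 ^+ n * r) z.
Proof.
apply: contraNP => yz; apply/eqP; rewrite /piece.
have [_ _ supp _ _] := at_a.
rewrite (_ : (fun u => _) = fun=> 0); first exact: (@integral_complex0 _ _ _ P).
apply/funext => u; rewrite indicE; have [uE|uE] := boolP (u \in E); last by rewrite !mul0r.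
have [az|az] := eqVneq (a (A u z)) 0; first by rewrite az mulr0.
by exfalso; apply: yz; have [_] := E_cell (set_mem uE); apply; exact: supp.
Qed.

Lemma integral_piece : cintegral mu (piece E a) = 0.
Proof.
have [_ _ _ _ int0] := at_a.
exact: (integral_superposed_piece minc mact pres mPhi (fun=> mE) Phi1
  (fun=> ma) (fun=> a1) (m := 0%N) int0).
Qed.

(** The normalization that turns the bound [cabs_piece_le] into the one required
    of an atom of the ball of [y] and [2 ^ n * r]. *)
Definition piece_weight : R := piece_mass E * (ball_mass mu (2 ^+ n * r) / ball_mass mu r).

Lemma piece_weight_ge0 : 0 <= piece_weight.
Proof. by rewrite mulr_ge0 ?piece_mass_ge0// divr_ge0// ltW. Qed.

Definition piece_atom (z : G) : R[i] := ((piece_weight^-1)%:C)%C * piece E a z.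

(** If the weight is zero, so is [piece_mass E], and the piece vanishes. *)
Lemma piece_atomK z : (piece_weight%:C)%C * piece_atom z = piece E a z.
Proof.
rewrite /piece_atom mulrA -rmorphM/=.
have [w0|w0] := eqVneq piece_weight 0; last by rewrite mulfV// mul1r.
rewrite w0 mul0r mul0r; apply/esym/ComplexField.Normc.eq0_normc/eqP.
rewrite eq_le (cabs_ge0 (piece E a z)) andbT.
apply: le_trans (cabs_piece_le z) _.
move: w0 => /eqP; rewrite /piece_weight mulf_eq0 mulf_eq0 invr_eq0.
rewrite (gt_eqF mass_gt0) (gt_eqF mass2_gt0) !orbF.
by move=> /eqP ->; rewrite mulr0.
Qed.

Lemma piece_atom_atom : atom mu piece_atom.
Proof.
split.
  exact: measurable_complexM (measurable_complex_cst _) mpiece.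
exists y, (2 ^+ n * r); split.
- by rewrite mulr_gt0// exprn_gt0.
- move=> z /=; rewrite mulf_eq0 negb_or => /andP[_]; exact: piece_support.
- rewrite (haar_ballE compactG invG haar_mu) [fine _]/=.
  apply: atom_bound_intro; first by rewrite invr_ge0 ltW.
  move=> z; rewrite cabsM cabs_real ger0_norm ?invr_ge0 ?piece_weight_ge0//.
  have [w0|w0] := eqVneq piece_weight 0.
    by rewrite w0 invr0 mul0r invr_ge0 ltW.
  have wpos : 0 < piece_weight by rewrite lt_neqAle eq_sym w0 piece_weight_ge0.
  rewrite ler_pdivrMl//; apply: le_trans (cabs_piece_le z) _.
  rewrite /piece_weight le_eqVlt; apply/orP; left; apply/eqP; field.
  by rewrite (gt_eqF mass_gt0) (gt_eqF mass2_gt0).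
- transitivity ((piece_weight^-1)%:C%C * cintegral mu (piece E a)); last first.
    by rewrite integral_piece mulr0.
  apply: (@integral_complexZ _ _ _ P); apply/integrable_complexP; split => //.
  rewrite pieceE; exact: (superposed_piece_L1 minc mact pres mPhi
    (fun=> 0%N) (fun=> mE) Phi1 (fun=> ma) (fun=> a1) 0%N).
Qed.

Lemma piece_weight_le : (piece_weight%:E <=
  \int[P]_(u in E) (Cmu * (cabs (Phi u) * k u `^ (ln Cmu / ln 2)))%:E)%E.
Proof.
have C0 : 0 <= Cmu.
  exact: le_trans (doubling_constant_ge1 compactG invG haar_mu homG).
rewrite /piece_weight mulrC EFinM -piece_massE//.
have mw : measurable_fun setT
    (fun u : X => Cmu * (cabs (Phi u) * k u `^ (ln Cmu / ln 2))).
  apply: measurable_funM; first exact: measurable_cst.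
  apply: measurable_funM; first exact: measurable_cabs.
  exact: (measurableT_comp (measurable_powR _)).
have c0 : 0 <= ball_mass mu (2 ^+ n * r) / ball_mass mu r by rewrite divr_ge0// ltW.
apply: (L1_set_le P mPhi mE mw c0) => u Eu.
rewrite mulrCA mulrC ler_wpM2l ?cabs_ge0//.
apply: le_trans (pullback_cell_bound (E_cell Eu)).
rewrite ler_pdivrMr//; exact: doubling_iter.
Qed.

End one_piece.

End pieces.

(** * Atomic decomposition of the image of a function *)

Section hausdorff.
Context {R : realType} {G : metricGroupType R}.
Hypothesis compactG : compact [set: G].
Hypothesis invG : left_invariant_metric G.
Variable mu : {measure set (borel G) -> \bar R}.
Hypothesis haar_mu : haar_measure mu.
Hypothesis homG : homogeneous_type mu.
Variable A : G -> automorphism G.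
Hypothesis mA : measurable_aut mu A.
Variable k : G -> R.
Hypothesis k_gt0 : forall u, 0 < k u.
Hypothesis mk : measurable_fun [set: completed_space mu]
            (k : completed_space mu -> R).
Hypothesis kA : forall (u x : G) (r : R), 0 < r ->
       exists x' : G, A u @^-1` ball x r `<=` ball x' (k u * r).
Variable Phi : G -> R[i].
Hypothesis Phi_loc : clocally_integrable mu Phi.

Local Notation X := (completed_space mu).
Local Notation P := (finite_copy (completed_lty (haar_lty compactG haar_mu))).
Local Notation Cmu := (doubling_constant mu).
Local Notation s := (ln Cmu / ln 2).
Local Notation W := (weighted_L1_norm mu k s Phi).
Local Notation T := (hausdorff_operator mu Phi A).

Let mPhi : measurable_complex (Phi : X -> R[i]).
Proof. by have [] := Phi_loc. Qed.

Let Phi1 : (\int[P]_u (cabs (Phi u))%:E < +oo)%E.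
Proof. by have [_] := Phi_loc; apply. Qed.

Let mact := measurable_aut_action compactG mA.
Let minc := @measurable_identity_completed R G mu.
Let pres := aut_action_preserves compactG invG haar_mu A.

Lemma ae_automorphisms (Q : G -> Prop) : {ae completed mu, forall x, Q x} ->
  {ae completed mu, forall x, {ae completed mu, forall u, Q (A u x)}}.
Proof.
move=> aeQ; have [N [mN N0 QN]] := completed_null (haar_lty compactG haar_mu) aeQ.
have PN0 : P (@identity_completed _ _ mu @^-1` N) = 0%E.
  by rewrite -[RHS]N0; exact: completedE.
have ex : exists N, [/\ measurable N, P (@identity_completed _ _ mu @^-1` N) = 0%E &
    ~` Q `<=` N] by exists N.
exact: (ae_act mact pres ex).
Qed.

Lemma ae_null_borel (N : set (borel G)) : measurable N -> mu N = 0%E ->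
  {ae completed mu, forall x : X, ~ N x}.
Proof.
move=> mN N0; exists N; split; [exact: completed_measurable| |by move=> y /= /contrapT].
by rewrite -[RHS]N0; exact: completedE.
Qed.

(** Some partial sum is at distance at most [1], and it is integrable. *)
Lemma atomic_decomposition_L1 (f' : G -> R[i]) (l : nat -> R[i]) (a' : nat -> G -> R[i]) :
  measurable_complex (f' : X -> R[i]) ->
  (forall j, measurable_complex (a' j : X -> R[i])) ->
  (forall j, \int[P]_y (cabs (a' j y))%:E <= 1)%E ->
  (\sum_(0 <= j <oo) (cabs (l j))%:E < +oo)%E ->
  (fun n => \int[P]_y (cabs (f' y - \sum_(j < n) l j * a' j y))%:E)%E @ \oo --> 0%E ->
  (\int[P]_y (cabs (f' y))%:E < +oo)%E.
Proof.
move=> mf' ma' a1 lS /cvge0P.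
move=> /(_ (fun n => integral_ge0 _ (fun y _ => _)))/wrap[n y|]; first by rewrite lee_fin cabs_ge0.
move=> /(_ 1 ltr01)[n /(_ n (leqnn n)) fn].
pose S (y : X) := \sum_(j < n) l j * a' j y.
have mS : measurable_complex S.
  apply: measurable_complex_sum => j; apply: measurable_complexM.
    exact: measurable_complex_cst.
  exact: ma'.
have -> : (fun y => (cabs (f' y))%:E) = (fun y => (cabs ((f' y - S y) - (- S y)))%:E).
  by apply/funext => y; rewrite opprK subrK.
apply: le_lt_trans (L1_triangle P _ _) _.
- exact: measurable_complexB.
- exact: measurable_complexN.
apply: lte_add_pinfty; first by apply: le_lt_trans fn _; rewrite ltry.
under eq_integral do rewrite cabsN.
have := @L1_sum_le _ _ _ P (index_iota 0 n) l a' ma' a1.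
under eq_integral do rewrite big_mkord.
move=> /le_lt_trans; apply; rewrite sumEFin ltry//.
Qed.

(** The series for [f] is replaced by a Borel one, and its terms are superposed
    over the cells of [exists_pullback_partition]. *)
Lemma hausdorff_decomposition (f : G -> R[i]) (l : nat -> R[i]) (a : nat -> G -> R[i]) :
  (W < +oo)%E -> cmeasurable mu f -> atomic_decomposition mu f l a ->
  [/\ {ae completed mu, forall x, cintegrable mu (fun u => Phi u * f (A u x))},
      cmeasurable mu (T f)
    & exists l' a', atomic_decomposition mu (T f) l' a' /\
      (\sum_(0 <= j <oo) (cabs (l' j))%:E <=
       (Cmu%:E * W) * \sum_(0 <= j <oo) (cabs (l j))%:E)%E].
Proof.
move=> Woo mf fla; have [_ lS _] := fla.
have [N [f' [a' [x [r [[mN N0] mf' ff' at_a' fa']]]]]] :=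
  borel_decomposition compactG invG haar_mu mf fla.
have ma' j : measurable_complex (a' j : borel G -> R[i]) by have [] := at_a' j.
have a1 j := borel_atom_L1 compactG invG haar_mu (at_a' j).
have r0 j : 0 < r j by have [] := at_a' j.
have f1 : (\int[P]_y (cabs (f' y))%:E < +oo)%E.
  apply: (atomic_decomposition_L1 _ _ a1 lS fa').
    exact: completed_measurable_complex.
  by move=> j; exact: completed_measurable_complex.
have aeff' : {ae completed mu, forall x, {ae completed mu, forall u,
    Phi u * f' (A u x) = Phi u * f (A u x)}}.
  have /ae_automorphisms : {ae completed mu, forall x, f' x = f x}.
    by apply: (ae_imply _ (ae_null_borel mN N0)) => z /ff' ->.
  by apply: ae_imply => z; apply: ae_imply => u ->.
have cP : measure_is_complete (completed mu) := @completed_is_complete _ _ _ mu.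
have intf' : {ae completed mu, forall z, cintegrable mu (fun u => Phi u * f' (A u z))}.
  exact: (ae_integrable_superposition minc mact pres
    (measurable_product_kernel mPhi mf') (product_kernel_lty minc mPhi Phi1 mf' f1)).
have TfTf' : {ae completed mu, forall z, T f' z = T f z}.
  apply: (ae_imply2 _ aeff' intf') => z eqz [h1 h2].
  apply: (ae_eq_integral_complex_complete cP eqz).
  by have /integrable_complexP[] : integrable_complex (completed mu)
    (fun u => Phi u * f' (A u z)) by split.
have mTf' : cmeasurable mu (T f').
  exact: (measurable_superposition P mact (measurable_product_kernel mPhi mf')).
have mTf : cmeasurable mu (T f) by exact: (ae_eq_measurable_complex cP TfTf' mTf').
split=> //.
  apply: (ae_imply2 _ aeff' intf') => z eqz intz.
  exact: (ae_eq_integrable_complex cP eqz intz).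
have [term_of [E [y [n [mE E_inj E_all E_cell]]]]] :=
  exists_pullback_partition compactG mA mk kA x r0.
pose w m := piece_weight compactG haar_mu Phi (r (term_of m)) (E m) (n m).
pose al m := piece_atom compactG haar_mu A Phi (r (term_of m)) (a' (term_of m)) (E m) (n m).
pose l' m := l (term_of m) * ((w m)%:C)%C.
have w0 m : 0 <= w m by apply: piece_weight_ge0.
have l'E m z : l' m * al m z = l (term_of m) * piece A Phi (E m) (a' (term_of m)) z.
  rewrite /l' -mulrA; congr (_ * _).
  exact: (piece_atomK invG mA mPhi Phi1 (n m) (at_a' (term_of m)) (mE m)).
have l'S : (\sum_(0 <= j <oo) (cabs (l' j))%:E <=
   (Cmu%:E * W) * \sum_(0 <= j <oo) (cabs (l j))%:E)%E.
  pose v u := Cmu * (cabs (Phi u) * k u `^ s).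
  have C0 : 0 <= Cmu.
    exact: le_trans (doubling_constant_ge1 compactG invG haar_mu homG).
  have mv0 : measurable_fun setT (fun u : X => cabs (Phi u) * k u `^ s).
    apply: measurable_funM; first exact: measurable_cabs.
    exact: (measurableT_comp (measurable_powR _)).
  have mv : measurable_fun setT (v : X -> R) by exact: measurable_funM.
  have v0 u : 0 <= v u by rewrite mulr_ge0// mulr_ge0 ?cabs_ge0// powR_ge0.
  have vW : (\int[P]_u (v u)%:E = Cmu%:E * W)%E.
    have mv0E := (measurable_EFinP setT _).2 mv0.
    have v00 u : setT u -> (0 <= (cabs (Phi u) * k u `^ s)%:E)%E.
      by move=> _; rewrite lee_fin mulr_ge0 ?cabs_ge0// powR_ge0.
    have CE : (0 <= Cmu%:E)%E by rewrite lee_fin.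
    exact (@ge0_integralZl _ _ _ (completed mu) _ measurableT _ mv0E _ v00 CE).
  apply: lime_le.
    by apply: is_cvg_nneseries => m _ _; rewrite lee_fin cabs_ge0.
  apply: nearW => q; rewrite /= big_mkord -vW muleC.
  apply: (le_trans _ (superposed_coef_sum_le P l mE E_inj q mv v0)).
  apply: lee_sum => m _; rewrite /l' cabsM cabs_real ger0_norm// EFinM.
  apply: lee_wpmul2l; first by rewrite lee_fin cabs_ge0.
  exact (piece_weight_le invG homG k_gt0 mk kA mPhi Phi1
    (at_a' (term_of m)) (mE m) (@E_cell m)).
exists l', al; split; last exact: l'S.
split.
- move=> m; exact (piece_atom_atom invG mA mPhi Phi1
    (at_a' (term_of m)) (mE m) (@E_cell m)).
- have W0 : (0 <= W)%E.
    by apply: integral_ge0 => u _; rewrite lee_fin mulr_ge0 ?cabs_ge0// powR_ge0.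
  have C0 : (0 <= Cmu%:E)%E.
    by rewrite lee_fin (le_trans ler01)// doubling_constant_ge1.
  have Wfin : W \is a fin_num by rewrite (ge0_fin_numE W0).
  apply: le_lt_trans l'S _; apply: (lte_mul_pinfty _ _ lS); first exact: mule_ge0.
  by apply: fin_numM.
have cvg' := superposed_series_cvg minc mact pres mPhi mE E_inj E_all lS Phi1 mf' f1
  ma' a1 fa'.
pose sup m : X -> R[i] := superposition P (@aut_action _ _ mu A)
  (piece_kernel (Phi : X -> R[i]) term_of E (a' : nat -> borel G -> R[i]) m).
have msup m : measurable_complex (sup m).
  exact: (measurable_superposition P mact (measurable_piece_kernel mPhi term_of mE ma' m)).
have mlsup m : measurable_complex (fun z => l (term_of m) * sup m z).
  exact: measurable_complexM (measurable_complex_cst _) (msup m).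
have l'sup m z : l' m * al m z = l (term_of m) * sup m z by exact: l'E.
rewrite (_ : (fun q => _) = fun q =>
   (\int[P]_z (cabs (T f' z - \sum_(m < q) l (term_of m) * sup m z))%:E)%E); first exact: cvg'.
apply/funext => q; apply: (@ae_eq_L1 _ _ _ (completed mu)).
- apply: measurable_complexB; first exact: mTf.
  apply: measurable_complex_sum => m.
  rewrite (_ : (fun z => _) = (fun z => l (term_of m) * sup m z)); first exact: mlsup.
  by apply/funext => z; exact: l'sup.
- apply: measurable_complexB; first exact: mTf'.
  by apply: measurable_complex_sum => m; exact: mlsup.
apply: (ae_imply _ TfTf') => z ->; congr (_ - _).
by apply: eq_bigr => m _; exact: l'sup.
Qed.

End hausdorff.

(** * The operator norm *)

Section operator_norm.
Context {R : realType} {G : metricGroupType R}.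
Variable mu : {measure set (borel G) -> \bar R}.

(** A decomposition of [f] with coefficients of sum less than [1 + d] gives the
    bound [M * (1 + d)]; here [d] is chosen with [M * d <= e]. *)
Lemma H1_operator_norm_le (T : (G -> R[i]) -> G -> R[i]) (M : R) : 0 <= M ->
  (forall f l a, cmeasurable mu f -> atomic_decomposition mu f l a ->
     exists l' a', atomic_decomposition mu (T f) l' a' /\
     (\sum_(0 <= j <oo) (cabs (l' j))%:E <=
       M%:E * \sum_(0 <= j <oo) (cabs (l j))%:E)%E) ->
  (H1_operator_norm mu T <= M%:E)%E.
Proof.
move=> M0 bnd; apply: ge_ereal_sup => _ [f [[mf _] f1] <-].
apply/lee_addgt0Pr => e e0.
have d0 : 0 < e / (M + 1) by rewrite divr_gt0// ltr_wpDl.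
have [|c [l [a [fla ->]]] cl] := @ereal_inf_lt _
    [set c | exists l a, atomic_decomposition mu f l a /\
      c = (\sum_(0 <= j <oo) (cabs (l j))%:E)%E] (1 + e / (M + 1))%:E.
  by apply: le_lt_trans f1 _; rewrite lte_fin ltrDl.
have [l' [a' [Tfla l'l]]] := bnd f l a mf fla.
apply: (@le_trans _ _ (\sum_(0 <= j <oo) (cabs (l' j))%:E)%E).
  by apply: ereal_inf_lbound; exists l', a'.
apply: le_trans l'l _; apply: (@le_trans _ _ (M%:E * (1 + e / (M + 1))%:E)%E).
  by apply: lee_wpmul2l; [rewrite lee_fin|exact: ltW].
rewrite -EFinM -EFinD lee_fin mulrDr mulr1 lerD2l mulrCA ger_pMr//.
by rewrite ler_pdivrMr ?mul1r ?lerDl// ltr_wpDl.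
Qed.

End operator_norm.

Unset Implicit Arguments.

Theorem corollary1 (R : realType) (G : metricGroupType R)
    (compactG : compact [set: G]) (lieG : lie_group G)
    (invG : left_invariant_metric G)
    (mu : {measure set (borel G) -> \bar R}) (haar_mu : haar_measure mu)
    (homG : homogeneous_type mu)
    (A : G -> automorphism G) (mA : measurable_aut mu A)
    (k : G -> R) (k_gt0 : forall u, 0 < k u)
    (mk : measurable_fun [set: completed_space mu]
            (k : completed_space mu -> R))
    (kA : forall (u x : G) (r : R), 0 < r ->
       exists x' : G, A u @^-1` ball x r `<=` ball x' (k u * r))
    (Phi : G -> R[i]) (Phi_loc : clocally_integrable mu Phi) :
  let Cmu := doubling_constant mu in
  let s := ln Cmu / ln 2 in
  (weighted_L1_norm mu k s Phi < +oo)%E ->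
  [/\ forall f, in_H1 mu f ->
        {ae completed mu, forall x, cintegrable mu (fun u => Phi u * f (A u x))},
      H1_bounded mu (hausdorff_operator mu Phi A)
    & (H1_operator_norm mu (hausdorff_operator mu Phi A)
         <= Cmu%:E * weighted_L1_norm mu k s Phi)%E].
Proof.
move=> Cmu s Woo; set T := hausdorff_operator mu Phi A.
have dec f l a (mf : cmeasurable mu f) (fla : atomic_decomposition mu f l a) :=
  hausdorff_decomposition compactG invG haar_mu homG mA k_gt0 mk kA Phi_loc Woo mf fla.
have int f : in_H1 mu f ->
    {ae completed mu, forall x, cintegrable mu (fun u => Phi u * f (A u x))}.
  by move=> [mf [l [a fla]]]; have [] := dec f l a mf fla.
have W0 : (0 <= weighted_L1_norm mu k s Phi)%E.
  by apply: integral_ge0 => u _; rewrite lee_fin mulr_ge0 ?cabs_ge0// powR_ge0.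
have Wfin : weighted_L1_norm mu k s Phi \is a fin_num by rewrite ge0_fin_numE.
have C0 : 0 <= Cmu.
  exact: le_trans (doubling_constant_ge1 compactG invG haar_mu homG).
have bound : (H1_operator_norm mu T <= Cmu%:E * weighted_L1_norm mu k s Phi)%E.
  rewrite -(fineK Wfin) -EFinM; apply: H1_operator_norm_le.
    by rewrite mulr_ge0// fine_ge0.
  move=> f l a mf fla; rewrite EFinM fineK//.
  by have [_ _] := dec f l a mf fla.
split; [exact: int| |exact: bound].
split.
- move=> f [mf [l [a fla]]]; have [_ mTf [l' [a' [Tfla _]]]] := dec f l a mf fla.
  by split; [exact: mTf|exists l', a'].
- move=> f g hf hg fg.
  apply: (ae_imply2 _ (ae_automorphisms compactG invG haar_mu mA fg) (int f hf)).
  move=> x fgx [h1 h2].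
  have cP : measure_is_complete (completed mu) := @completed_is_complete _ _ _ mu.
  apply: (ae_eq_integral_complex_complete cP).
    by apply: (ae_imply _ fgx) => u ->.
  by have /integrable_complexP[] : integrable_complex (completed mu)
    (fun u => Phi u * f (A u x)) by split.
- move=> c f g hf hg; apply: (ae_imply2 _ (int f hf) (int g hg)) => x hfx hgx.
  have If : integrable_complex (completed mu) (fun u => Phi u * f (A u x)) by exact: hfx.
  have Ig : integrable_complex (completed mu) (fun u => Phi u * g (A u x)) by exact: hgx.
  have E := integral_complexD (integrable_complexZ c If) Ig.
  rewrite (integral_complexZ c If) in E.
  rewrite -[RHS]E; congr integral_complex; apply/funext => u.
  by rewrite mulrDr mulrCA.
- apply: le_lt_trans bound _; apply: lte_mul_pinfty Woo; rewrite ?lee_fin//.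
Qed.
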